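(* Let $\Gamma$ be a circle of radius $R$ with center $O$ in a plane $\Pi\subset\mathbb{R}^3$, let $l$ be the line through $O$ perpendicular to $\Pi$, and let $O_0\ne O_1$ be points of $l$ not in $\Pi$. Let $\mathcal D=\bigcup_{Y\in\Gamma}\operatorname{conv}\{O_0,O_1,Y\}$ be the dicone with vertices $O_0,O_1$, and for $i=0,1$ let $\mathcal U_{O_i}=\bigcup_{Y\in\Gamma}O_iY$ be the lateral conical surface with apex $O_i$. Let $f$ be a convex function defined on $\mathcal D$, and let $g(\mathbf x)=\frac{f(\mathbf x)}{\operatorname{dist}(\mathbf x,l)}$, where $\operatorname{dist}(\mathbf x,l)$ is the distance from $\mathbf x$ to $l$. Then $$\operatorname{Avg}(f,\mathcal D)\le\frac R4\left(\operatorname{Avg}(g,\mathcal U_{O_0})+\operatorname{Avg}(g,\mathcal U_{O_1})\right).$$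
   Context: $\operatorname{Avg}(f,\mathcal D)$ is the average of $f$ over $\mathcal D$ with respect to volume, and $\operatorname{Avg}(g,\mathcal U_{O_i})=\frac{1}{\operatorname{Area}(\mathcal U_{O_i})}\iint_{\mathcal U_{O_i}}g\,dS$ is the average with respect to surface area. *)

(* Defs.v *)
From HB Require Import structures.
From mathcomp Require Import all_boot all_order all_algebra.
From mathcomp Require Import all_classical all_reals all_analysis.
Set Implicit Arguments. Unset Strict Implicit. Unset Printing Implicit Defensive.
Import Order.TTheory GRing.Theory Num.Theory.
Import numFieldNormedType.Exports.
Local Open Scope classical_set_scope.
Local Open Scope ring_scope.

(* Points of R^3 are triples ((x, y), z); this is the product measurable type
   carrying the product Lebesgue measure. *)
Section Geometry3.
Variable R : realType.

Definition vec3 := ((R * R) * R)%type.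

Definition mkv (x y z : R) : vec3 := ((x, y), z).
Definition vx (v : vec3) : R := v.1.1.
Definition vy (v : vec3) : R := v.1.2.
Definition vz (v : vec3) : R := v.2.

Definition vadd (u v : vec3) : vec3 := mkv (vx u + vx v) (vy u + vy v) (vz u + vz v).
Definition vsub (u v : vec3) : vec3 := mkv (vx u - vx v) (vy u - vy v) (vz u - vz v).
Definition vscale (a : R) (v : vec3) : vec3 := mkv (a * vx v) (a * vy v) (a * vz v).
Definition dot (u v : vec3) : R := vx u * vx v + vy u * vy v + vz u * vz v.
Definition cross (u v : vec3) : vec3 :=
  mkv (vy u * vz v - vz u * vy v) (vz u * vx v - vx u * vz v) (vx u * vy v - vy u * vx v).
Definition vnorm (v : vec3) : R := Num.sqrt (dot v v).

Definition plane (O n : vec3) : set vec3 := [set x | dot (vsub x O) n = 0].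
Definition line (O n : vec3) : set vec3 := [set vadd O (vscale s n) | s in [set: R]].
Definition circle (O n : vec3) (Rad : R) : set vec3 :=
  [set Y | plane O n Y /\ vnorm (vsub Y O) = Rad].

Definition dist_line (x O n : vec3) : R :=
  inf [set vnorm (vsub x (vadd O (vscale s n))) | s in [set: R]].

Definition conv3 (a b c : vec3) : set vec3 :=
  [set x | exists la lb lc : R, [/\ 0 <= la, 0 <= lb, 0 <= lc, la + lb + lc = 1 &
     x = vadd (vadd (vscale la a) (vscale lb b)) (vscale lc c)]].

Definition dicone (O0 O1 : vec3) (Gam : set vec3) : set vec3 :=
  \bigcup_(Y in Gam) conv3 O0 O1 Y.

Definition segment (P Y : vec3) : set vec3 :=
  [set vadd P (vscale t (vsub Y P)) | t in `[0, 1]].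

Definition lateral (P : vec3) (Gam : set vec3) : set vec3 :=
  \bigcup_(Y in Gam) segment P Y.

Definition convex_on (D : set vec3) (f : vec3 -> R) : Prop :=
  forall x y, D x -> D y -> forall t : R, 0 <= t <= 1 ->
    f (vadd (vscale t x) (vscale (1 - t) y)) <= t * f x + (1 - t) * f y.

Definition leb3 := ((@lebesgue_measure R \x @lebesgue_measure R) \x @lebesgue_measure R)%E.
Definition leb2 := (@lebesgue_measure R \x @lebesgue_measure R)%E.

Definition avg_vol (f : vec3 -> R) (D : set vec3) : R :=
  fine (\int[leb3]_(x in D) (f x)%:E)%E / fine (leb3 D).

Definition dpar_s (Phi : R -> R -> vec3) (s t : R) : vec3 :=
  mkv (derive1 (fun u => vx (Phi u t)) s) (derive1 (fun u => vy (Phi u t)) s)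
      (derive1 (fun u => vz (Phi u t)) s).
Definition dpar_t (Phi : R -> R -> vec3) (s t : R) : vec3 :=
  mkv (derive1 (fun u => vx (Phi s u)) t) (derive1 (fun u => vy (Phi s u)) t)
      (derive1 (fun u => vz (Phi s u)) t).
Definition area_elt (Phi : R -> R -> vec3) (s t : R) : R :=
  vnorm (cross (dpar_s Phi s t) (dpar_t Phi s t)).

Definition surf_integrand (Phi : R -> R -> vec3) (g : vec3 -> R) (p : R * R) : \bar R :=
  (g (Phi p.1 p.2) * area_elt Phi p.1 p.2)%:E.

Definition surf_int (Phi : R -> R -> vec3) (A : set (R * R)) (g : vec3 -> R) : \bar R :=
  (\int[leb2]_(p in A) surf_integrand Phi g p)%E.

(* Parametrisation of the lateral surface U_P with apex P over the circle of
   radius Rad centred at O in the plane spanned by orthonormal e1, e2: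
   (s, t) in [0,1] x [0, 2 pi] |-> P + s (Y(t) - P),
   Y(t) = O + Rad (cos t e1 + sin t e2). *)
Definition circ_pt (O e1 e2 : vec3) (Rad t : R) : vec3 :=
  vadd O (vadd (vscale (Rad * cos t) e1) (vscale (Rad * sin t) e2)).
Definition cone_param (P O e1 e2 : vec3) (Rad : R) (s t : R) : vec3 :=
  vadd P (vscale s (vsub (circ_pt O e1 e2 Rad t) P)).
Definition cone_dom : set (R * R) := `[0, 1] `*` `[0, 2 * pi].

Definition avg_cone (g : vec3 -> R) (P O e1 e2 : vec3) (Rad : R) : R :=
  fine (surf_int (cone_param P O e1 e2 Rad) cone_dom g) /
  fine (surf_int (cone_param P O e1 e2 Rad) cone_dom (fun _ => 1)).

End Geometry3.

(* Main.v *)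
Require Import Defs.
From HB Require Import structures.
From mathcomp Require Import all_boot all_order all_algebra.
From mathcomp Require Import all_classical all_reals all_analysis.
From mathcomp Require Import measurable_realfun ring lra.
Set Implicit Arguments.
Unset Strict Implicit.
Unset Printing Implicit Defensive.
Import Order.TTheory GRing.Theory Num.Theory.
Import numFieldNormedType.Exports.
Local Open Scope classical_set_scope.
Local Open Scope ring_scope.

(** Put [O0 = O + a n] and [O1 = O + b n], and parametrise the dicone by
    [Phi (s, t, w) = (1 - w) F0 (s, t) + w F1 (s, t)], where [F0] and [F1] are the
    parametrisations of the two cones and [s, w] range over [[0, 1]], [t] over
    [[0, 2 pi]].  The Jacobian is [Rad^2 |b - a| s (1 - s)]; it is obtained from the
    invariance of Lebesgue measure under isometries, polar coordinates and affine
    substitutions, all for nonnegative measurable functions.  Convexity along the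
    segment from [F0] to [F1] bounds the integral of [f] over the dicone by
    [Rad^2 |b - a| / 2] times the integral of [s (1 - s) (f o F0 + f o F1)].  For a
    convex [h] on [[0, 1]] one has [6 * int s (1 - s) h <= int h], because
    [1 - 6 s (1 - s)] is orthogonal to affine functions and changes sign exactly
    where [h] crosses its chord through the two roots.  Dividing by the distance to
    the axis turns surface area on the cones into [ds dt], which is the right-hand
    side. *)

(** Apart from the isometry, every substitution is reduced to one real variable: uniqueness of
    Lebesgue measure makes it enough to compare two measures on half-open intervals, and Tonelli
    assembles the pieces. Polar coordinates thus need no planar Jacobian: on each horizontal line of
    height [y != 0] put [x = - y tan t], exchange the integrals, then put [y = r cos t]. A rotation
    mixes the coordinates, so it cannot be treated one variable at a time and gets an averaging
    argument over a ball instead.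

    The polynomial [1 - 6 s (1 - s)] is the shifted Legendre polynomial of degree two, whence its
    orthogonality to affine functions; [6] is the inverse of the integral of [s (1 - s)]. It is used
    on each generator of the two cones, along which [f] is convex. The apex needs care: its distance
    to the axis is [0], so [g] is [0] there by the convention for division, and the function pulled
    back to [[0, 1]] need not be convex at [s = 0]. As this is a null set of parameters, the
    convexity argument is run on []0, 1]]. *)

(** * Substitution by weighted image measures *)

Section weighted_image.
Local Open Scope ereal_scope.
Context d1 d2 (X : measurableType d1) (Y : measurableType d2) (R : realType).
Variables (mu : {measure set X -> \bar R}) (phi : X -> Y) (k : X -> R).
Hypotheses (mphi : measurable_fun setT phi) (mk : measurable_fun setT k).
Hypothesis k0 : forall x, (0 <= k x)%R.

(** The image under [phi] of the measure with density [k] with respect to [mu]. A one-variable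
    substitution formula says that Lebesgue measure is such an image. *)
Definition weighted_image (A : set Y) := \int[mu]_(x in phi @^-1` A) (k x)%:E.

Let weighted_image0 : weighted_image set0 = 0.
Proof. by rewrite /weighted_image preimage_set0 integral_set0. Qed.

Let weighted_image_ge0 A : 0 <= weighted_image A.
Proof. by apply: integral_ge0 => x _; rewrite lee_fin. Qed.

Let measurable_preimage A : measurable A -> measurable (phi @^-1` A).
Proof. by move=> mA; rewrite -[X in measurable X]setTI; exact: mphi. Qed.

Let weighted_image_additive : semi_sigma_additive weighted_image.
Proof.
move=> F mF tF mUF; rewrite /weighted_image preimage_bigcup.
rewrite ge0_integral_bigcup//=.
- by apply: is_cvg_ereal_nneg_natsum_cond => n _ _; exact: weighted_image_ge0.
- by move=> n; exact: measurable_preimage.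
- by apply/measurable_EFinP; apply: (measurable_funS measurableT).
- by move=> x _; rewrite lee_fin.
- apply/trivIsetP => /= i j _ _ ij; rewrite -preimage_setI.
  by move/trivIsetP : tF => /(_ _ _ _ _ ij) ->//; rewrite preimage_set0.
Qed.

HB.instance Definition _ := isMeasure.Build _ _ _
  weighted_image weighted_image0 weighted_image_ge0 weighted_image_additive.

Definition weighted_image_measure : {measure set Y -> \bar R} := weighted_image.

Import HBNNSimple.

(** Both sides are additive and continuous along increasing sequences in [f], so an agreement on
    indicators extends through simple functions. A change of variables is thereby reduced to an
    identity between measures of sets. *)
Lemma ge0_integral_weighted_image (nu : {measure set Y -> \bar R})
    (f : Y -> \bar R) :
  (forall A, measurable A -> nu A = weighted_image A) ->
  measurable_fun setT f -> (forall y, 0 <= f y) ->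
  \int[nu]_y f y = \int[mu]_x ((k x)%:E * f (phi x)).
Proof.
move=> nuE mf f0.
have meas_comp (g : Y -> \bar R) : measurable_fun setT g ->
    measurable_fun setT (fun x => (k x)%:E * g (phi x)).
  move=> mg; apply: emeasurable_funM; first exact/measurable_EFinP.
  exact: measurableT_comp.
pose h := nnsfun_approx measurableT mf.
have -> : \int[nu]_y f y = limn (fun n => \int[nu]_y (h n y)%:E).
  rewrite -monotone_convergence//.
  - apply: eq_integral => y _; apply/esym/cvg_lim => //.
    by apply: cvg_nnsfun_approx => // *; exact: f0.
  - by move=> n; exact/measurable_EFinP.
  - by move=> n y _; rewrite lee_fin.
  - by move=> y _ m n mn; rewrite lee_fin; exact/lefP/nd_nnsfun_approx.
have -> : \int[mu]_x ((k x)%:E * f (phi x)) =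
    limn (fun n => \int[mu]_x ((k x)%:E * (h n (phi x))%:E)).
  rewrite -monotone_convergence//.
  - apply: eq_integral => x _; apply/esym/cvg_lim => //; apply: cvgeZl => //.
    by apply: cvg_nnsfun_approx => // *; exact: f0.
  - by move=> n; apply: (meas_comp (EFin \o h n)); exact/measurable_EFinP.
  - by move=> n y _; rewrite mule_ge0 ?lee_fin.
  - move=> x _ m n mn; rewrite lee_wpmul2l ?lee_fin//.
    exact/lefP/nd_nnsfun_approx.
congr (limn _); apply/funext => n.
have mr r : measurable (h n @^-1` [set r]) by exact: measurable_sfunP.
transitivity (\sum_(r \in range (h n)) \int[mu]_x
    ((k x)%:E * (r * \1_(h n @^-1` [set r]) (phi x))%:E)); last first.
  rewrite -ge0_integral_fsum//.
  - apply: eq_integral => x _; rewrite [in RHS]fimfunE -fsumEFin//.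
    rewrite ge0_mule_fsumr// => r; exact: nnfun_muleindic_ge0.
  - move=> r; apply: (meas_comp (fun y => (r * \1_(h n @^-1` [set r]) y)%:E)).
    by apply/measurable_EFinP; exact: measurable_funM.
  - move=> r x _; rewrite mule_ge0 ?lee_fin//.
    by rewrite -lee_fin; exact: nnfun_muleindic_ge0.
under eq_integral do rewrite fimfunE -fsumEFin//.
rewrite ge0_integral_fsum//; last 2 first.
- by move=> r; exact/measurable_EFinP/measurable_funM.
- by move=> r y _; rewrite nnfun_muleindic_ge0.
apply: eq_fsbigr => r /set_mem[y _ ry].
have r0 : (0 <= r)%R by rewrite -ry.
under eq_integral do rewrite EFinM.
rewrite integralZl_indic_nnsfun// integral_indic// setIT nuE//.
under [RHS]eq_integral do rewrite EFinM muleCA.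
rewrite ge0_integralZl//; last 2 first.
- apply: (meas_comp (fun y => (\1_(h n @^-1` [set r]) y)%:E)).
  exact/measurable_EFinP.
- by move=> x _; rewrite mule_ge0 ?lee_fin.
congr (_ * _); rewrite /weighted_image integral_mkcond.
by apply: eq_integral => x _; rewrite epatch_indic /= !indicE.
Qed.

End weighted_image.

(** * Affine and tangent substitutions on the real line *)

Section substitution.
Local Open Scope ereal_scope.
Context {R : realType}.
Local Notation mu := (@lebesgue_measure R).

Lemma measurable_affine (c d : R) :
  measurable_fun [set: R] (fun x : R => c * x + d)%R.
Proof. by apply: measurable_funD => //; exact: measurable_funM. Qed.

(** By uniqueness of Lebesgue measure it suffices to measure preimages of intervals []a, b]]. For
    negative [c] the open and closed ends are exchanged, which leaves the length unaffected. *)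
Lemma ge0_integral_affine (c d : R) (f : R -> \bar R) : (c != 0)%R ->
  measurable_fun setT f -> (forall x, 0 <= f x) ->
  \int[mu]_x f x = `|c|%:E * \int[mu]_x f (c * x + d)%R.
Proof.
move=> c0 mf f0.
pose phi : measurableTypeR R -> measurableTypeR R := fun x => (c * x + d)%R.
have mphi : measurable_fun setT phi by exact: measurable_affine.
have mk : measurable_fun setT (cst `|c|%R : measurableTypeR R -> R) by [].
have k0 x : (0 <= (cst `|c| : measurableTypeR R -> R) x)%R by rewrite /= normr_ge0.
rewrite (@ge0_integral_weighted_image _ _ (measurableTypeR R) (measurableTypeR R)
  R mu phi (cst `|c|%R) mphi mk k0 mu f _ mf f0); last first.
  move=> A; apply: (@lebesgue_measure_unique R (weighted_image_measure mu mphi mk k0)).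
  move=> _ [[a b]] _ <-.
  have mab : measurable (phi @^-1` `]a, b]).
    by rewrite -[X in measurable X]setTI; exact: mphi.
  rewrite [RHS](@integral_cst _ _ _ mu _ mab `|c|%:E)/=.
  have [cp|cn|] := ltgtP 0%R c; last by move=> c0'; rewrite -c0' eqxx in c0.
  - have -> : phi @^-1` `]a, b] = `]((a - d) / c)%R, ((b - d) / c)%R]%classic.
      apply/seteqP; split => x; rewrite /phi/= !in_itv/= ltr_pdivrMr// ler_pdivlMr//.
        by rewrite ltrBlDr lerBrDr mulrC.
      by rewrite ltrBlDr lerBrDr mulrC.
    rewrite !lebesgue_measure_itv/= !lte_fin ltr_pM2r ?invr_gt0// ltrD2r.
    case: ifPn => _; last by rewrite mule0.
    rewrite -!EFinB -EFinM gtr0_norm//; congr EFin; field; exact: lt0r_neq0.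
  - have -> : phi @^-1` `]a, b] = `[((b - d) / c)%R, ((a - d) / c)%R[%classic.
      apply/seteqP; split => x; rewrite /phi/= !in_itv/= ltr_ndivlMr// ler_ndivrMr//.
        by rewrite ltrBlDr lerBrDr [(x * c)%R]mulrC andbC.
      by rewrite ltrBlDr lerBrDr [(x * c)%R]mulrC andbC.
    rewrite !lebesgue_measure_itv/= !lte_fin ltr_nM2r ?invr_lt0// ltrD2r.
    case: ifPn => _; last by rewrite mule0.
    rewrite -!EFinB -EFinM ltr0_norm//; congr EFin; field.
    by rewrite lt_eqF.
rewrite /= (@ge0_integralZl _ _ _ mu _ measurableT (f \o phi))//.
  exact: (measurableT_comp mf mphi).
by move=> x _; exact: f0.
Qed.

Lemma ge0_integral_affine_in (c d : R) (A : set R) (f : R -> \bar R) :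
  (c != 0)%R -> measurable A -> measurable_fun setT f -> (forall x, 0 <= f x) ->
  \int[mu]_(x in A) f x =
  `|c|%:E * \int[mu]_(x in (fun x => c * x + d)%R @^-1` A) f (c * x + d)%R.
Proof.
move=> c0 mA mf f0; rewrite integral_mkcond (ge0_integral_affine d c0).
- by rewrite [in RHS]integral_mkcond.
- by apply/(measurable_restrictT _ _).1 => //; exact: measurable_funTS.
- by move=> x; rewrite patchE; case: ifPn.
Qed.

Local Notation I := `](- (pi / 2))%R, (pi / 2)%R[%classic.

(** The extension by [0] makes the branch total and measurable on the line. Its values outside the
    open interval are harmless, since the weight [sec2_branch] vanishes there. *)
Definition tan_branch : R -> R := tan \_ I.
Definition sec2_branch : R -> R := (fun t => (cos t)^-2)%R \_ I.

Let cosI (t : R) : I t -> (0 < cos t)%R.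
Proof. by rewrite /= in_itv/= => tI; exact: cos_gt0_pihalf. Qed.

Let ctan : {in I, continuous (@tan R)}.
Proof.
by move=> t /set_mem/cosI ct; apply: continuous_tan; rewrite gt_eqF.
Qed.

Let ccos : {in I, continuous (fun t : R => (cos t)^-2)%R}.
Proof.
move=> t /set_mem/cosI ct; apply: cvgV; first by rewrite expf_neq0// gt_eqF.
by apply: cvgM; exact: continuous_cos.
Qed.

Lemma measurable_tan_branch : measurable_fun setT tan_branch.
Proof.
apply/(measurable_restrictT _ _).1; first exact: measurable_itv.
by apply: open_continuous_measurable_fun => //; exact: interval_open.
Qed.

Lemma measurable_sec2_branch : measurable_fun setT sec2_branch.
Proof.
apply/(measurable_restrictT _ _).1; first exact: measurable_itv.
by apply: open_continuous_measurable_fun => //; exact: interval_open.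
Qed.

Lemma sec2_branch_ge0 t : (0 <= sec2_branch t)%R.
Proof.
by rewrite /sec2_branch patchE; case: ifPn => // _; rewrite invr_ge0 exprn_even_ge0.
Qed.

(** On intervals this is the fundamental theorem of calculus: the derivative [(cos t)^-2] of [tan]
    integrates to [b - a] between [atan a] and [atan b]. *)
Lemma ge0_integral_tan (f : R -> \bar R) :
  measurable_fun setT f -> (forall x, 0 <= f x) ->
  \int[mu]_x f x = \int[mu]_t ((sec2_branch t)%:E * f (tan_branch t)).
Proof.
move=> mf f0.
pose phi : measurableTypeR R -> measurableTypeR R := tan_branch.
pose k : measurableTypeR R -> R := sec2_branch.
have mphi : measurable_fun setT phi by exact: measurable_tan_branch.
have mk : measurable_fun setT k by exact: measurable_sec2_branch.
have k0 x : (0 <= k x)%R by exact: sec2_branch_ge0.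
have mI : measurable (I : set R) by exact: measurable_itv.
rewrite (@ge0_integral_weighted_image _ _ (measurableTypeR R) (measurableTypeR R)
  R mu phi k mphi mk k0 mu f _ mf f0); last first.
  move=> A; apply: (@lebesgue_measure_unique R (weighted_image_measure mu mphi mk k0)).
  move=> _ [[a b]] _ <-; rewrite /= /weighted_image.
  rewrite integral_mkcond.
  have [ba|ab] := leP b a.
    rewrite set_itv_ge ?bnd_simp -?leNgt// measure0 preimage_set0.
    by rewrite integral0_eq// => x _; rewrite patchE in_set0.
  have sub x : `]atan a, atan b]%classic x -> (I : set R) x.
    rewrite /= !in_itv/= => /andP[ax xb].
    by rewrite (lt_trans (atan_gtNpi2 a) ax) (le_lt_trans xb (atan_ltpi2 b)).
  have subc x : `[atan a, atan b]%classic x -> (I : set R) x.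
    rewrite /= !in_itv/= => /andP[ax xb].
    by rewrite (lt_le_trans (atan_gtNpi2 a) ax) (le_lt_trans xb (atan_ltpi2 b)).
  (* The preimage of []a, b]] may also contain everything outside the branch, where [tan_branch] is
     [0]; the zero weight removes that part. *)
  transitivity (\int[mu]_(x in `]atan a, atan b]) ((cos x)^-2)%:E); last first.
    rewrite [LHS]integral_mkcond; apply: eq_integral => x _; rewrite !patchE.
    have [xI|xI] := boolP (x \in I); last first.
      rewrite (_ : x \in `]atan a, atan b]%classic = false); last first.
        by apply/negP => /set_mem/sub/mem_set; exact/negP.
      by case: ifPn => //; rewrite /k /sec2_branch patchE (negbTE xI).
    rewrite /k /sec2_branch patchE xI.
    suff -> : (x \in phi @^-1` `]a, b]) = (x \in `]atan a, atan b]%classic) by [].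
    have -> : (x \in phi @^-1` `]a, b]) = (tan x \in `]a, b]).
      by apply/idP/idP; rewrite in_setE /= /phi /tan_branch patchE xI.
    have -> : (x \in `]atan a, atan b]%classic) = (x \in `]atan a, atan b]).
      by apply/idP/idP; rewrite in_setE.
    have /tanK tanx : x \in `](- (pi / 2))%R, (pi / 2)%R[ by move/set_mem: xI.
    rewrite !in_itv/= -{3 4}tanx; congr andb.
      apply/idP/idP; first exact: lt_atan.
      by apply: contraTT; rewrite -!leNgt; exact: le_atan.
    apply/idP/idP; first exact: le_atan.
    by apply: contraTT; rewrite -!ltNge; exact: lt_atan.
  rewrite integral_itv_obnd_cbnd; last first.
    apply/measurable_EFinP; apply: (@measurable_funS _ _ _ _ I) => //.
    by apply: open_continuous_measurable_fun => //; exact: interval_open.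
  rewrite (@continuous_FTC2 _ _ tan).
  - by rewrite !atanK lebesgue_measure_itv/= lte_fin ab.
  - exact: lt_atan.
  - apply: continuous_in_subspaceT => x /set_mem/subc xI.
    by apply: ccos; exact/mem_set.
  - split.
    + move=> x xab; apply: derivable_tan; rewrite gt_eqF// cosI//.
      by apply: sub; apply: subset_itv_oo_oc xab.
    + apply: cvg_at_right_filter; apply: ctan; apply/mem_set/subc => /=.
      by rewrite in_itv/= lexx/= ltW// lt_atan.
    + apply: cvg_at_left_filter; apply: ctan; apply/mem_set/subc => /=.
      by rewrite in_itv/= lexx/= andbT ltW// lt_atan.
  - move=> x xab; rewrite derive1E; apply: derive_val.
    apply: is_derive_tan; rewrite gt_eqF// cosI//.
    by apply: sub; apply: subset_itv_oo_oc xab.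
by [].
Qed.

End substitution.

(** * Polar coordinates in the plane *)

Section polar.
Local Open Scope ereal_scope.
Context {R : realType}.
Local Notation mu := (@lebesgue_measure R).
Variable H : R * R -> \bar R.
Hypotheses (mH : measurable_fun setT H) (H0 : forall p, 0 <= H p).

Let K (t r : R) : \bar R := `|r|%:E * H (r * cos t, r * sin t)%R.

Let K_ge0 t r : 0 <= K t r.
Proof. by rewrite mule_ge0. Qed.

Let mcos : measurable_fun setT (@cos R).
Proof. by apply: continuous_measurable_fun; exact: continuous_cos. Qed.

Let msin : measurable_fun setT (@sin R).
Proof. by apply: continuous_measurable_fun; exact: continuous_sin. Qed.

Let mK : measurable_fun setT (fun p : R * R => K p.1 p.2).
Proof.
apply: emeasurable_funM.
  by apply/measurable_EFinP; apply: measurableT_comp.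
apply: (measurableT_comp mH); apply/measurable_fun_pairP; split => /=.
  by apply: measurable_funM => //; exact: measurableT_comp mcos _.
by apply: measurable_funM => //; exact: measurableT_comp msin _.
Qed.

Let mKt t : measurable_fun setT (K t).
Proof. exact: (measurableT_comp mK (measurable_pair1 t)). Qed.

(** The integrand after [x = - y tan t] at fixed height [y], with [p = (t, y)]. *)
Let W (p : R * R) : \bar R :=
  `|p.2|%:E * ((sec2_branch p.1)%:E * H (- p.2 * tan_branch p.1, p.2)%R).

Let W_ge0 p : 0 <= W p.
Proof. by rewrite !mule_ge0// lee_fin sec2_branch_ge0. Qed.

Let mW : measurable_fun setT W.
Proof.
apply: emeasurable_funM; first by apply/measurable_EFinP; apply: measurableT_comp.
apply: emeasurable_funM.
  apply/measurable_EFinP.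
  exact: (measurableT_comp measurable_sec2_branch measurable_fst).
apply: (measurableT_comp mH); apply/measurable_fun_pairP; split => /=; last exact: measurable_snd.
apply: measurable_funM; first by apply: measurableT_comp => //; exact: measurable_snd.
exact: (measurableT_comp measurable_tan_branch measurable_fst).
Qed.

(** With [y = r cos t] the factors [cos t] from [dy] and from [|y|] cancel the weight [(cos t)^-2]
    and leave [|r|]. The point [(- y tan t, y)] becomes [(- r sin t, r cos t)], whose angle is
    [t + pi / 2]. *)
Let integral_W t : (- (pi / 2) < t < pi / 2)%R ->
  \int[mu]_y W (t, y) = \int[mu]_r K (t + pi / 2)%R r.
Proof.
move=> tI; have ct : (0 < cos t)%R by exact: cos_gt0_pihalf.
rewrite (@ge0_integral_affine R (cos t) 0)//; last 2 first.
- by rewrite gt_eqF.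
- exact: (measurableT_comp mW (measurable_pair1 t)).
rewrite -ge0_integralZl//; last first.
  apply: (measurableT_comp mW); apply: (measurableT_comp (measurable_pair1 t)).
  exact: measurable_affine.
apply: eq_integral => r _; rewrite /W /K /= addr0 /sec2_branch /tan_branch !patchE.
rewrite mem_set/= ?in_itv//= !muleA -!EFinM; congr (_%:E * H _).
  by rewrite normrM (gtr0_norm ct); field; rewrite gt_eqF.
rewrite cosDpihalf sinDpihalf /tan; congr (_, _); last by rewrite mulrC.
by field; rewrite gt_eqF.
Qed.

(** Polar coordinates with a signed radius: each line through the origin is traversed once, so the
    angle ranges over a half-turn only. *)
Let integral_line :
  \int[@leb2 R]_p H p = \int[mu]_(t in `]0%R, pi[) \int[mu]_r K t r.
Proof.
rewrite /leb2 fubini_tonelli2//.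
transitivity (\int[mu]_y \int[mu]_t W (t, y)).
  apply: ge0_ae_eq_integral => //.
  - exact: measurable_fun_fubini_tonelli_G.
  - exact: (@measurable_fun_fubini_tonelli_G _ _ _ _ _ mu W).
  - by move=> y _; exact: integral_ge0.
  - by move=> y _; exact: integral_ge0.
  (* On the line [y = 0] the substitution [x = - y tan t] degenerates; that height is a null set. *)
  exists [set 0%R]; split => //; first exact: lebesgue_measure_set1.
  move=> y /=; apply: contra_notP => /eqP y0 _; rewrite /fubini_G.
  have mHy : measurable_fun setT (fun x => H (x, y)).
    exact: (measurableT_comp mH (measurable_pair2 y)).
  rewrite (@ge0_integral_affine R (- y)%R 0)// ?oppr_eq0// normrN.
  have mHy' : measurable_fun setT (fun x => H (- y * x + 0, y)%R).
    by apply: (measurableT_comp mHy); exact: measurable_affine.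
  rewrite ge0_integral_tan//.
  rewrite -ge0_integralZl//; last 2 first.
  - apply: emeasurable_funM.
      by apply/measurable_EFinP; exact: measurable_sec2_branch.
    exact: (measurableT_comp mHy' measurable_tan_branch).
  - by move=> t _; rewrite mule_ge0// lee_fin sec2_branch_ge0.
  by apply: eq_integral => t _; rewrite /W /= addr0.
rewrite -(@fubini_tonelli _ _ _ _ _ mu mu W)//.
rewrite [RHS](@ge0_integral_affine_in R 1 (pi / 2))// ?oner_eq0//; last 2 first.
- exact: (@measurable_fun_fubini_tonelli_F _ _ _ _ _ mu (fun p => K p.1 p.2)).
- by move=> t; exact: integral_ge0.
rewrite normr1 mul1e [RHS]integral_mkcond; apply: eq_integral => t _.
rewrite patchE; have [/set_mem/=|tI] := boolP (_ \in _).
  rewrite in_itv/= mul1r => /andP[t0 tp].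
  by rewrite -integral_W//; apply/andP; split; lra.
apply: integral0_eq => y _; rewrite /W /sec2_branch patchE memNset ?mul0e ?mule0//=.
apply: contraNnot tI; rewrite in_itv/= => /andP[t0 tp]; apply/mem_set => /=.
by rewrite in_itv/= mul1r; apply/andP; split; lra.
Qed.

Lemma ge0_integral_polar : \int[@leb2 R]_p H p =
  \int[mu]_(t in `[0%R, (2 * pi)%R])
    \int[mu]_(r in `[0%R, +oo[) (r%:E * H (r * cos t, r * sin t)%R).
Proof.
pose Psi t := \int[mu]_(r in `[0%R, +oo[) K t r.
have mPsi : measurable_fun setT Psi.
  rewrite /Psi; under eq_fun do rewrite integral_mkcond.
  apply: (@measurable_fun_fubini_tonelli_F _ _ _ _ _ mu
    (fun p => (K p.1 \_ `[0%R, +oo[) p.2)).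
    rewrite (_ : (fun _ => _) = (fun p => K p.1 p.2) \_ (setT `*` `[0%R, +oo[)).
      apply/(measurable_restrictT _ _).1; last exact: measurable_funTS.
      exact: measurableX.
    apply/funext => -[t r]; rewrite !patchE/=.
    by rewrite (_ : ((t, r) \in _) = (r \in `[0%R, +oo[%classic))// in_setX in_setT.
  by move=> [t r]; rewrite patchE; case: ifPn.
have Psi_ge0 t : 0 <= Psi t by exact: integral_ge0.
(* A negative radius at angle [t] is a positive radius at angle [t + pi]; this unfolds the half-turn
   into the full turn. *)
have KE t : \int[mu]_r K t r = Psi t + Psi (t + pi)%R.
  have -> : [set: R] = `]-oo, 0%R[%classic `|` `[0%R, +oo[%classic.
    by rewrite -itv_bndbnd_setU// set_itvNyy.
  rewrite ge0_integral_setU//; last 2 first.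
  - exact: measurable_funTS (mKt t).
  - by apply/disj_set2P/seteqP; split => // x []/=; rewrite !in_itv/= andbT; lra.
  rewrite addeC; congr (_ + _).
  rewrite (@ge0_integral_affine_in R (-1) 0)// ?oppr_eq0 ?oner_eq0//.
  rewrite normrN normr1 mul1e.
  rewrite (_ : _ @^-1` _ = `]0%R, +oo[%classic); last first.
    by apply/seteqP; split => x /=; rewrite !in_itv/= ?andbT; lra.
  rewrite integral_itv_obnd_cbnd; last first.
    apply: measurable_funTS; apply: (measurableT_comp (mKt t)).
    exact: measurable_affine.
  apply: eq_integral => r _; rewrite /K addr0 mulN1r normrN cosDpi sinDpi.
  by rewrite !mulNr !mulrN.
rewrite integral_line.
transitivity (\int[mu]_(t in `[0%R, (2 * pi)%R]) Psi t); last first.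
  apply: eq_integral => t _; apply: eq_integral => r /set_mem/=.
  by rewrite in_itv/= andbT => r0; rewrite /K ger0_norm.
under eq_integral do rewrite KE.
have pi0 : (0 < pi :> R)%R by exact: pi_gt0.
have mPsis : measurable_fun setT (fun t : R => Psi (t + pi)%R).
  by apply: (measurableT_comp mPsi); exact: measurable_funD.
rewrite ge0_integralD//; last 2 first.
- exact: measurable_funTS.
- exact: measurable_funTS.
have -> : (`[0%R, (2 * pi)%R]%classic : set R) =
    `[0%R, pi]%classic `|` `]pi, (2 * pi)%R]%classic.
  rewrite -itv_bndbnd_setU// ?bnd_simp; [exact: ltW|lra].
rewrite ge0_integral_setU//; last 2 first.
- exact: measurable_funTS.
- by apply/disj_set2P/seteqP; split => // x []/=; rewrite !in_itv/= => /andP[_ +] /andP[]; lra.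
congr (_ + _).
  rewrite integral_itv_obnd_cbnd; last exact: measurable_funTS.
  by rewrite integral_itv_bndo_bndc//; exact: measurable_funTS.
rewrite [RHS](@ge0_integral_affine_in R 1 pi)// ?oner_eq0// normr1 mul1e.
rewrite (_ : _ @^-1` _ = `]0%R, pi]%classic); last first.
  apply/seteqP; split => x /=; rewrite !in_itv/= mul1r => /andP[xp xpp];
  by apply/andP; split; lra.
rewrite integral_itv_bndo_bndc; last exact: measurable_funTS.
by apply: eq_integral => t _; rewrite mul1r.
Qed.

End polar.

(** * Invariance of product measures under coordinatewise maps *)

Section product_invariance.
Local Open Scope ereal_scope.
Context d1 d2 (T1 : measurableType d1) (T2 : measurableType d2) (R : realType).
Variables (m1 : {sigma_finite_measure set T1 -> \bar R})
  (m2 : {sigma_finite_measure set T2 -> \bar R}) (phi1 : T1 -> T1) (phi2 : T2 -> T2).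
Hypotheses (mphi1 : measurable_fun setT phi1) (mphi2 : measurable_fun setT phi2).
Hypothesis inv1 : forall f : T1 -> \bar R, measurable_fun setT f ->
  (forall x, 0 <= f x) -> \int[m1]_x f (phi1 x) = \int[m1]_x f x.
Hypothesis inv2 : forall f : T2 -> \bar R, measurable_fun setT f ->
  (forall x, 0 <= f x) -> \int[m2]_x f (phi2 x) = \int[m2]_x f x.

Lemma ge0_integral_prod_invariant (f : T1 * T2 -> \bar R) :
  measurable_fun setT f -> (forall p, 0 <= f p) ->
  \int[m1 \x m2]_p f (phi1 p.1, phi2 p.2) = \int[m1 \x m2]_p f p.
Proof.
move=> mf f0.
have mphi : measurable_fun setT (fun p : T1 * T2 => (phi1 p.1, phi2 p.2)).
  apply/measurable_fun_pairP; split.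
    exact: (measurableT_comp mphi1 measurable_fst).
  exact: (measurableT_comp mphi2 measurable_snd).
rewrite (fubini_tonelli1 (fun p => f (phi1 p.1, phi2 p.2)))//; last first.
  exact: (measurableT_comp mf mphi).
rewrite fubini_tonelli1// /fubini_F /=.
transitivity (\int[m1]_x \int[m2]_y f (phi1 x, y)).
  apply: eq_integral => x _; rewrite (inv2 (f := fun y => f (phi1 x, y)))//.
  exact: (measurableT_comp mf (measurable_pair1 _)).
rewrite (inv1 (f := fun x => \int[m2]_y f (x, y)))//.
- exact: measurable_fun_fubini_tonelli_F.
- by move=> x; exact: integral_ge0.
Qed.

End product_invariance.

(** * Algebra and measurability of vector operations *)

Section vector_algebra.
Context {R : realType}.
Implicit Types (u v w e : vec3 R).

Lemma vec3E u v : vx u = vx v -> vy u = vy v -> vz u = vz v -> u = v.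
Proof. by move: u v => [[? ?] ?] [[? ?] ?]; rewrite /vx /vy /vz /= => -> -> ->. Qed.

Lemma measurable_vx : measurable_fun setT (@vx R).
Proof. by apply: measurableT_comp; exact: measurable_fst. Qed.

Lemma measurable_vy : measurable_fun setT (@vy R).
Proof. by apply: (measurableT_comp measurable_snd); exact: measurable_fst. Qed.

Lemma measurable_vz : measurable_fun setT (@vz R).
Proof. exact: measurable_snd. Qed.

Lemma vnorm_ge0 u : 0 <= vnorm u.
Proof. exact: sqrtr_ge0. Qed.

Lemma dot_ge0 u : 0 <= dot u u.
Proof. by rewrite /dot -!expr2 !addr_ge0// sqr_ge0. Qed.

Lemma dotC u v : dot u v = dot v u.
Proof. by rewrite /dot; ring. Qed.

Lemma dotDl u v w : dot (vadd u v) w = dot u w + dot v w.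
Proof. by rewrite /dot /vadd /mkv /vx /vy /vz /=; ring. Qed.

Lemma dotZl (a : R) u v : dot (vscale a u) v = a * dot u v.
Proof. by rewrite /dot /vscale /mkv /vx /vy /vz /=; ring. Qed.

Lemma dotDr u v w : dot u (vadd v w) = dot u v + dot u w.
Proof. by rewrite !(dotC u) dotDl. Qed.

Lemma dotZr (a : R) u v : dot u (vscale a v) = a * dot u v.
Proof. by rewrite !(dotC u) dotZl. Qed.

Lemma vnorm1_dot u : vnorm u = 1 -> dot u u = 1.
Proof. by move=> u1; rewrite -(sqr_sqrtr (dot_ge0 u)) -/(vnorm u) u1 expr1n. Qed.

Section measurable.
Context d (T : measurableType d).
Implicit Types f g : T -> vec3 R.

Lemma measurable_mkv (f g h : T -> R) : measurable_fun setT f ->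
  measurable_fun setT g -> measurable_fun setT h ->
  measurable_fun setT (fun x => mkv (f x) (g x) (h x) : (R * R * R)%type).
Proof.
move=> mf mg mh; apply/measurable_fun_pairP; split => //.
exact/measurable_fun_pairP.
Qed.

Lemma measurable_vadd f g : measurable_fun setT f -> measurable_fun setT g ->
  measurable_fun setT (fun x => vadd (f x) (g x) : (R * R * R)%type).
Proof.
move=> mf mg; apply: measurable_mkv; apply: measurable_funD.
- exact: (measurableT_comp measurable_vx mf).
- exact: (measurableT_comp measurable_vx mg).
- exact: (measurableT_comp measurable_vy mf).
- exact: (measurableT_comp measurable_vy mg).
- exact: (measurableT_comp measurable_vz mf).
- exact: (measurableT_comp measurable_vz mg).
Qed.

Lemma measurable_vscale (k : T -> R) f : measurable_fun setT k ->
  measurable_fun setT f ->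
  measurable_fun setT (fun x => vscale (k x) (f x) : (R * R * R)%type).
Proof.
move=> mk mf; apply: measurable_mkv; apply: measurable_funM => //.
- exact: (measurableT_comp measurable_vx mf).
- exact: (measurableT_comp measurable_vy mf).
- exact: (measurableT_comp measurable_vz mf).
Qed.

Lemma vsubE u v : vsub u v = vadd u (vscale (-1) v).
Proof. by apply: vec3E; rewrite /vsub /vadd /vscale /mkv /vx /vy /vz /= mulN1r. Qed.

Lemma measurable_vsub f g : measurable_fun setT f -> measurable_fun setT g ->
  measurable_fun setT (fun x => vsub (f x) (g x) : (R * R * R)%type).
Proof.
move=> mf mg; under eq_fun do rewrite vsubE.
by apply: measurable_vadd => //; exact: measurable_vscale.
Qed.

Lemma measurable_dot f g : measurable_fun setT f -> measurable_fun setT g ->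
  measurable_fun setT (fun x => dot (f x) (g x)).
Proof.
move=> mf mg; apply: measurable_funD; first apply: measurable_funD.
- by apply: measurable_funM; [exact: (measurableT_comp measurable_vx mf)|
    exact: (measurableT_comp measurable_vx mg)].
- by apply: measurable_funM; [exact: (measurableT_comp measurable_vy mf)|
    exact: (measurableT_comp measurable_vy mg)].
- by apply: measurable_funM; [exact: (measurableT_comp measurable_vz mf)|
    exact: (measurableT_comp measurable_vz mg)].
Qed.

End measurable.

End vector_algebra.

(** * Coordinates in an orthonormal frame *)

Section orthonormal_frame.
Context {R : realType}.
Variables e1 e2 e3 : vec3 R.
Hypotheses (e11 : dot e1 e1 = 1) (e22 : dot e2 e2 = 1) (e33 : dot e3 e3 = 1).
Hypotheses (e12 : dot e1 e2 = 0) (e13 : dot e1 e3 = 0) (e23 : dot e2 e3 = 0).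
Implicit Types u v : vec3 R.

Definition lincomb v : vec3 R :=
  vadd (vadd (vscale (vx v) e1) (vscale (vy v) e2)) (vscale (vz v) e3).

Definition coords v : vec3 R := mkv (dot v e1) (dot v e2) (dot v e3).

Lemma lincombK v : coords (lincomb v) = v.
Proof.
rewrite /coords /lincomb !dotDl !dotZl !(dotC e2 e1, dotC e3) e11 e22 e33 e12 e13 e23.
by apply: vec3E; rewrite /mkv /vx /vy /vz /=; ring.
Qed.

Lemma dot_lincomb v : dot (lincomb v) (lincomb v) = dot v v.
Proof.
rewrite /lincomb !(dotDl, dotZl, dotDr, dotZr) !(dotC e2 e1, dotC e3).
by rewrite e11 e22 e33 e12 e13 e23 /dot; ring.
Qed.

(** Orthonormality says that the matrix of the frame has a right inverse, its transpose. For a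
    square matrix this is also a left inverse, and the entries of that second identity are the
    relations that rebuild each coordinate of [v]. *)
Lemma coordsK v : lincomb (coords v) = v.
Proof.
pose M : 'M[R]_3 := \matrix_(i, j)
  let e := if i == 0 then e1 else if i == 1 then e2 else e3 in
  if j == 0 then vx e else if j == 1 then vy e else vz e.
have dotE (i j : 'I_3) : (M *m M^T) i j =
    dot (if i == 0 then e1 else if i == 1 then e2 else e3)
        (if j == 0 then e1 else if j == 1 then e2 else e3).
  by rewrite !mxE !big_ord_recl big_ord0 !mxE /= /dot addr0 addrA.
have /mulmx1C MM : M *m M^T = 1%:M.
  apply/matrixP => i j; rewrite dotE mxE.
  by case: i => -[|[|[|//]]] i; case: j => -[|[|[|//]]] j //=;
    rewrite ?(dotC e2 e1) ?(dotC e3).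
have MME (i j : 'I_3) := congr1 (fun A : 'M[R]_3 => A i j) MM.
have := (MME 0 0, MME 0 1, MME 0 2%:R, MME 1 1, MME 1 2%:R, MME 2%:R 2%:R).
rewrite !mxE !big_ord_recl !big_ord0 !mxE /= !addr0.
move=> [] [] [] [] [] hxx hxy hxz hyy hyz hzz.
apply: vec3E; rewrite /lincomb /coords /vadd /vscale /mkv /dot {1}/vx {1}/vy {1}/vz /=.
- transitivity (vx v * (vx e1 * vx e1 + (vx e2 * vx e2 + vx e3 * vx e3))
    + vy v * (vx e1 * vy e1 + (vx e2 * vy e2 + vx e3 * vy e3))
    + vz v * (vx e1 * vz e1 + (vx e2 * vz e2 + vx e3 * vz e3))).
    by rewrite /vx /vy /vz /=; ring.
  by rewrite hxx hxy hxz; ring.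
- transitivity (vx v * (vx e1 * vy e1 + (vx e2 * vy e2 + vx e3 * vy e3))
    + vy v * (vy e1 * vy e1 + (vy e2 * vy e2 + vy e3 * vy e3))
    + vz v * (vy e1 * vz e1 + (vy e2 * vz e2 + vy e3 * vz e3))).
    by rewrite /vx /vy /vz /=; ring.
  by rewrite hxy hyy hyz; ring.
- transitivity (vx v * (vx e1 * vz e1 + (vx e2 * vz e2 + vx e3 * vz e3))
    + vy v * (vy e1 * vz e1 + (vy e2 * vz e2 + vy e3 * vz e3))
    + vz v * (vz e1 * vz e1 + (vz e2 * vz e2 + vz e3 * vz e3))).
    by rewrite /vx /vy /vz /=; ring.
  by rewrite hxz hyz hzz; ring.
Qed.

End orthonormal_frame.

(* In the library the finite-measure instance of [\x] shadows the sigma-finite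
   one, hence these copies of [leb2] and [leb3]. *)
Definition lebesgue2 {R : realType} :
    set (measurableTypeR R * measurableTypeR R)%type -> \bar R :=
  (@lebesgue_measure R \x @lebesgue_measure R)%E.

HB.instance Definition _ (R : realType) := Measure.on (@lebesgue2 R).
HB.instance Definition _ (R : realType) :=
  Measure_isSigmaFinite.Build _ _ _ (@lebesgue2 R)
    (lebesgue_integral_fubini.product_measure_sigma_finite_subproof
      lebesgue_measure lebesgue_measure).

Definition lebesgue3 {R : realType} :
    set (measurableTypeR R * measurableTypeR R * measurableTypeR R)%type -> \bar R :=
  (@lebesgue2 R \x @lebesgue_measure R)%E.

HB.instance Definition _ (R : realType) := Measure.on (@lebesgue3 R).
HB.instance Definition _ (R : realType) :=
  Measure_isSigmaFinite.Build _ _ _ (@lebesgue3 R)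
    (lebesgue_integral_fubini.product_measure_sigma_finite_subproof
      lebesgue2 lebesgue_measure).

(** * Invariance of Lebesgue measure on space under isometries *)

Section isometry.
Local Open Scope ereal_scope.
Context {R : realType}.
Local Notation mu := (@lebesgue_measure R).
Local Notation V := (R * R * R)%type.

Lemma ge0_integral_translation (a : R) (f : R -> \bar R) :
  measurable_fun setT f -> (forall x, 0 <= f x) ->
  \int[mu]_x f (x + a)%R = \int[mu]_x f x.
Proof.
move=> mf f0; rewrite [RHS](@ge0_integral_affine R 1 a) ?oner_eq0//.
by rewrite normr1 mul1e; apply: eq_integral => x _; rewrite mul1r.
Qed.

Lemma ge0_integral_vadd (a : vec3 R) (f : V -> \bar R) :
  measurable_fun setT f -> (forall x, 0 <= f x) ->
  \int[lebesgue3]_v f (vadd v a) = \int[lebesgue3]_v f v.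
Proof.
move=> mf f0; pose shift (c x : R) := (x + c)%R.
have mshift c : measurable_fun [set: R] (shift c) by exact: measurable_funD.
have mshift2 : measurable_fun setT
    (fun p : R * R => (shift (vx a) p.1, shift (vy a) p.2)).
  apply/measurable_fun_pairP; split.
    exact: (measurableT_comp (mshift _) measurable_fst).
  exact: (measurableT_comp (mshift _) measurable_snd).
have inv1 c (g : R -> \bar R) : measurable_fun setT g -> (forall p, 0 <= g p) ->
    \int[mu]_p g (shift c p) = \int[mu]_p g p.
  by move=> mg g0; exact: ge0_integral_translation.
have inv2 (g : R * R -> \bar R) : measurable_fun setT g -> (forall p, 0 <= g p) ->
    \int[lebesgue2]_p g (shift (vx a) p.1, shift (vy a) p.2) = \int[lebesgue2]_p g p.
  by move=> mg g0; exact: (@ge0_integral_prod_invariant _ _ (measurableTypeR R)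
    (measurableTypeR R) R mu mu _ _ (mshift (vx a)) (mshift (vy a))
    (inv1 _) (inv1 _) g mg g0).
rewrite -[RHS](@ge0_integral_prod_invariant _ _
  (measurableTypeR R * measurableTypeR R)%type
  (measurableTypeR R) R lebesgue2 mu _ _ mshift2 (mshift (vz a)) inv2 (inv1 _) f mf f0).
by apply: eq_integral.
Qed.

Variables e1 e2 e3 : vec3 R.
Hypotheses (e11 : dot e1 e1 = 1%R) (e22 : dot e2 e2 = 1%R) (e33 : dot e3 e3 = 1%R).
Hypotheses (e12 : dot e1 e2 = 0%R) (e13 : dot e1 e3 = 0%R) (e23 : dot e2 e3 = 0%R).

Lemma measurable_lincomb : measurable_fun setT (lincomb e1 e2 e3 : V -> V).
Proof.
apply: measurable_vadd; first apply: measurable_vadd.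
- by apply: measurable_vscale => //; exact: measurable_vx.
- by apply: measurable_vscale => //; exact: measurable_vy.
- by apply: measurable_vscale => //; exact: measurable_vz.
Qed.

Let B : set V := [set v : vec3 R | (dot v v <= 1)%R].

Let mB : measurable B.
Proof.
rewrite -[B]setTI; have := @measurable_dot R _ V id id (@measurable_id _ _ _)
  (@measurable_id _ _ _).
by move=> /(_ measurableT `]-oo, 1%R]%classic (measurable_itv _));
  congr measurable; apply/seteqP; split => v /=; rewrite in_itv.
Qed.

Let leb3_box (r : R) : (0 <= r)%R ->
  lebesgue3 ((`[- r, r] `*` `[- r, r]) `*` `[- r, r])%R = ((r + r) ^+ 3)%:E.
Proof.
move=> r0; have mI : measurable (`[(- r)%R, r] : set R) by exact: measurable_itv.
have lI : mu `[(- r)%R, r] = (r + r)%:E.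
  rewrite lebesgue_measure_itv/= lte_fin; case: ltP => [_|rr].
    by rewrite -EFinD opprK.
  by congr EFin; lra.
rewrite [LHS]product_measure1E//; last exact: measurableX.
rewrite [X in (X * _)%E](product_measure1E lebesgue_measure lebesgue_measure)//.
by rewrite [X in (X * X * X)%E]lI -!EFinM; congr EFin; ring.
Qed.

(** The ball lies between cubes of sides [1] and [2]. A positive finite measure is what allows the
    factor [b] to be cancelled at the end of the averaging argument. *)
Let leb3B : exists2 b : R, (0 < b)%R & lebesgue3 B = b%:E.
Proof.
have Bub : lebesgue3 B <= 8%:E.
  have -> : 8%R = ((1 + 1) ^+ 3)%R :> R by ring.
  rewrite -leb3_box//; apply: le_measure; rewrite ?inE//.
    by do 2 (apply: measurableX => //); exact: measurable_itv.
  move=> [[x y] z]; rewrite /B /dot /vx /vy /vz /= !in_itv/= => xyz.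
  by do ![split]; apply/andP; split; nra.
have Blb : 1%:E <= lebesgue3 B.
  have -> : 1%R = ((2^-1 + 2^-1) ^+ 3)%R :> R by field.
  rewrite -leb3_box ?invr_ge0//; apply: le_measure; rewrite ?inE//.
    by do 2 (apply: measurableX => //); exact: measurable_itv.
  move=> [[x y] z]; rewrite /B /dot /vx /vy /vz /= !in_itv/=.
  by move=> [[/andP[? ?] /andP[? ?]] /andP[? ?]]; nra.
exists (fine (lebesgue3 B)).
  by rewrite fine_gt0// (lt_le_trans _ Blb)// (le_lt_trans Bub)// ltry.
by rewrite fineK// ge0_fin_numE// (le_lt_trans Bub)// ltry.
Qed.

(* With [B] the unit ball, evaluate the double integral of
   [G (T v) * 1_B (w - T v)] over [v] and [w] in both orders: translation
   invariance and the symmetry of [B] give [|B|] times either side. *)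
Lemma ge0_integral_isometry (O : vec3 R) (G : V -> \bar R) :
  measurable_fun setT G -> (forall v, 0 <= G v) ->
  \int[lebesgue3]_v G (vadd O (lincomb e1 e2 e3 v)) = \int[lebesgue3]_v G v.
Proof.
move=> mG G0; pose L : V -> V := lincomb e1 e2 e3.
pose T (v : V) : V := vadd O (L v).
have mT : measurable_fun setT T.
  by apply: measurable_vadd => //; exact: measurable_lincomb.
pose ind (v : V) : \bar R := (\1_B v)%:E.
have ind0 v : 0 <= ind v by rewrite lee_fin.
pose J (p : V * V) : \bar R := G (T p.1) * ind (vsub p.2 (T p.1)).
have mind : measurable_fun setT ind.
  by apply/measurable_EFinP.
have mJ : measurable_fun setT J.
  apply: emeasurable_funM.
    exact: (measurableT_comp mG (measurableT_comp mT measurable_fst)).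
  apply: (measurableT_comp mind); apply: measurable_vsub; first exact: measurable_snd.
  exact: (measurableT_comp mT measurable_fst).
have J0 p : 0 <= J p by rewrite mule_ge0.
have [b b0 bE] := leb3B.
have intB : \int[lebesgue3]_w ind w = b%:E by rewrite integral_indic// setIT.
have lhs : \int[lebesgue3]_v \int[lebesgue3]_w J (v, w) =
    b%:E * \int[lebesgue3]_v G (T v).
  rewrite -ge0_integralZl//; last 2 first.
  - exact: (measurableT_comp mG mT).
  - by rewrite lee_fin ltW.
  apply: eq_integral => v _; rewrite /J /=.
  have mv : measurable_fun setT (fun w : V => vsub w (T v) : V).
    by apply: measurable_vsub => //; exact: measurable_id.
  have mh : measurable_fun setT (fun w : V => ind (vsub w (T v))).
    exact: (measurableT_comp mind mv).
  rewrite (@ge0_integralZl _ _ R lebesgue3 _ measurableT _ mh)//.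
  rewrite muleC; congr (_ * _); under eq_integral do rewrite vsubE.
  by rewrite (ge0_integral_vadd _ (f := ind)).
have rhs : \int[lebesgue3]_w \int[lebesgue3]_v J (v, w) = b%:E * \int[lebesgue3]_v G v.
  transitivity (\int[lebesgue3]_w \int[lebesgue3]_v
      (ind v * G (vadd w (L v)))).
    apply: eq_integral => w _.
    (* Shifting [v] by the coordinates of [w - O] turns [T v] into [w + L v], so that the argument
       [w - T v] of the indicator becomes [- L v], which has the norm of [v]. *)
    rewrite -(@ge0_integral_vadd (coords e1 e2 e3 (vsub w O)))//; last first.
      exact: (measurableT_comp mJ (measurable_pair2 w)).
    apply: eq_integral => v _; rewrite /J /=.
    have -> : T (vadd v (coords e1 e2 e3 (vsub w O))) = vadd w (L v).
      have LD u u' : L (vadd u u') = vadd (L u) (L u').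
        by apply: vec3E; rewrite /L /lincomb /vadd /vscale /mkv /vx /vy /vz /=; ring.
      rewrite /T LD /L coordsK//.
      by apply: vec3E; rewrite /vsub /vadd /mkv /vx /vy /vz /=; ring.
    rewrite muleC; congr (_ * _); rewrite /ind !indicE.
    suff -> : (vsub w (vadd w (L v)) \in B) = (v \in B) by [].
    apply/idP/idP; rewrite !inE /B /= -(dot_lincomb e11 e22 e33 e12 e13 e23 v) -/(L v);
    by rewrite /dot /vsub /vadd /mkv /vx /vy /vz /=; lra.
  have mGB : measurable_fun setT
      (fun p : V * V => ind p.2 * G (vadd p.1 (L p.2))).
    apply: emeasurable_funM; first exact: (measurableT_comp mind measurable_snd).
    apply: (measurableT_comp mG); apply: measurable_vadd; first exact: measurable_fst.
    exact: (measurableT_comp measurable_lincomb measurable_snd).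
  rewrite (@fubini_tonelli _ _ _ _ _ lebesgue3 lebesgue3
    (fun p : V * V => ind p.2 * G (vadd p.1 (L p.2))))//; last first.
    by move=> p; rewrite mule_ge0.
  transitivity (\int[lebesgue3]_v (ind v * \int[lebesgue3]_w G w)).
    apply: eq_integral => v _ /=.
    have mv : measurable_fun setT (fun w : V => vadd w (L v) : V).
      by apply: measurable_vadd => //; exact: measurable_id.
    have mh : measurable_fun setT (fun w : V => G (vadd w (L v))).
      exact: (measurableT_comp mG mv).
    rewrite (@ge0_integralZl _ _ R lebesgue3 _ measurableT _ mh)//.
    by congr (_ * _); rewrite (ge0_integral_vadd _ (f := G)).
  rewrite ge0_integralZr//; last exact: integral_ge0.
  by rewrite intB.
have : b%:E * \int[lebesgue3]_v G (T v) = b%:E * \int[lebesgue3]_v G v.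
  by rewrite -lhs -rhs; exact: (@fubini_tonelli _ _ _ _ _ lebesgue3 lebesgue3 J).
move=> /(congr1 (mule (b^-1)%:E)); rewrite !muleA -EFinM mulVf ?gt_eqF//.
by rewrite !mul1e.
Qed.

End isometry.

(** * The dicone in cylindrical coordinates *)

Section dicone.
Context {R : realType}.
Local Notation V := (R * R * R)%type.
Variables (O e1 e2 n : vec3 R) (Rad a b : R).
Hypotheses (e11 : dot e1 e1 = 1) (e22 : dot e2 e2 = 1) (nn : dot n n = 1).
Hypotheses (e12 : dot e1 e2 = 0) (e1n : dot e1 n = 0) (e2n : dot e2 n = 0).
Hypotheses (Rad0 : 0 < Rad) (ab : a != b).

Let O0 := vadd O (vscale a n).
Let O1 := vadd O (vscale b n).
Let D := dicone O0 O1 (circle O n Rad).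

(* Cylindrical coordinates in the frame [(e1, e2, n)]; [t] is the polar angle,
   [s] the radius divided by [Rad], and [w] interpolates between the two cones. *)
Definition dicone_pt (p : V) : V :=
  vadd O (lincomb e1 e2 n (mkv (Rad * p.1.1 * cos p.1.2) (Rad * p.1.1 * sin p.1.2)
    ((1 - p.1.1) * (b - a) * p.2 + (1 - p.1.1) * a))).

Lemma cone_paramE (c s t : R) : cone_param (vadd O (vscale c n)) O e1 e2 Rad s t =
  vadd O (lincomb e1 e2 n (mkv (Rad * s * cos t) (Rad * s * sin t) ((1 - s) * c))).
Proof.
by apply: vec3E; rewrite /cone_param /circ_pt /lincomb /vsub /vadd /vscale /mkv
  /vx /vy /vz /=; ring.
Qed.

Lemma dicone_ptE s t w : dicone_pt ((s, t), w) =
  vadd (vscale (1 - w) (cone_param O0 O e1 e2 Rad s t))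
    (vscale w (cone_param O1 O e1 e2 Rad s t)).
Proof.
rewrite !cone_paramE /dicone_pt; apply: vec3E;
by rewrite /lincomb /vadd /vscale /mkv /vx /vy /vz /=; ring.
Qed.

Let vxE x y z : vx (mkv x y z) = x :> R. Proof. by []. Qed.
Let vyE x y z : vy (mkv x y z) = y :> R. Proof. by []. Qed.
Let vzE x y z : vz (mkv x y z) = z :> R. Proof. by []. Qed.

Let rho (u : vec3 R) := Num.sqrt (vx u ^+ 2 + vy u ^+ 2).

Let rho_ge0 u : 0 <= rho u. Proof. exact: sqrtr_ge0. Qed.

(** The sign of the product says that the height lies between the two cones at radius [rho u],
    whichever of [a] and [b] is the larger. *)
Let cyl : set V := [set u : vec3 R | rho u <= Rad /\
  (vz u - (1 - rho u / Rad) * a) * (vz u - (1 - rho u / Rad) * b) <= 0].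

Let cylE u : cyl u = (rho u <= Rad /\
  (vz u - (1 - rho u / Rad) * a) * (vz u - (1 - rho u / Rad) * b) <= 0) :> Prop.
Proof. by []. Qed.

Let mcyl : measurable cyl.
Proof.
have mrho : measurable_fun setT (rho : V -> R).
  apply: (measurableT_comp (continuous_measurable_fun (@sqrt_continuous R))).
  by apply: measurable_funD; apply: measurable_funX;
    [exact: measurable_vx|exact: measurable_vy].
have mz c : measurable_fun setT
    (fun u : V => vz u - (1 - rho u / Rad) * c : R).
  apply: measurable_funB; first exact: measurable_vz.
  apply: measurable_funM => //; apply: measurable_funB => //.
  exact: measurable_funM.
have -> : cyl = (rho @^-1` `]-oo, Rad]) `&`
    ((fun u : V => (vz u - (1 - rho u / Rad) * a) *
      (vz u - (1 - rho u / Rad) * b)) @^-1` `]-oo, 0]).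
  by apply/seteqP; split => u; rewrite /cyl /= !in_itv.
apply: measurableI; rewrite -[X in measurable X]setTI.
  by apply: mrho => //; exact: measurable_itv.
by apply: measurable_funM => //; exact: measurable_itv.
Qed.

(** A union over all points of the circle is not visibly measurable, whereas inequalities are. For a
    convex combination with weights [la, lb, lc], the radius is [lc * Rad] and the product in [cyl]
    equals [- la * lb * (b - a)^2]. *)
Let diconeE (v : vec3 R) : D v <-> cyl (coords e1 e2 n (vsub v O)).
Proof.
have Rad_neq0 : Rad != 0 by rewrite gt_eqF.
have vaddK (u w : vec3 R) : vsub (vadd u w) u = w.
  by apply: vec3E; rewrite /vsub /vadd /mkv /vx /vy /vz /=; ring.
have vsubK (u w : vec3 R) : vadd u (vsub w u) = w.
  by apply: vec3E; rewrite /vsub /vadd /mkv /vx /vy /vz /=; ring.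
have conv_coords (la lb lc : R) (Y : vec3 R) : la + lb + lc = 1 ->
    vsub (vadd (vadd (vscale la O0) (vscale lb O1)) (vscale lc Y)) O =
    vadd (vscale (la * a + lb * b) n) (vscale lc (vsub Y O)).
  move=> l1; have -> : la = 1 - lb - lc by rewrite -l1; ring.
  by apply: vec3E; rewrite /O0 /O1 /vsub /vadd /vscale /mkv /vx /vy /vz /=; ring.
split.
  move=> [Y [Yn YR]] [la [lb [lc [la0 lb0 lc0 l1 ->]]]].
  rewrite conv_coords//; set y := vsub Y O in Yn YR *.
  have y2 : dot y e1 ^+ 2 + dot y e2 ^+ 2 = Rad ^+ 2.
    rewrite -YR /vnorm sqr_sqrtr ?dot_ge0//.
    rewrite -[in RHS](coordsK e11 e22 nn e12 e1n e2n y) dot_lincomb//.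
    by rewrite /coords Yn /dot !vxE !vyE !vzE; ring.
  set u := coords _ _ _ _.
  have ux : vx u = lc * dot y e1.
    by rewrite /u /coords vxE dotDl !dotZl (dotC n) e1n; ring.
  have uy : vy u = lc * dot y e2.
    by rewrite /u /coords vyE dotDl !dotZl (dotC n) e2n; ring.
  have uz : vz u = la * a + lb * b.
    by rewrite /u /coords vzE dotDl !dotZl nn Yn; ring.
  have rhoE : rho u = lc * Rad.
    rewrite /rho ux uy !exprMn -mulrDr y2 -exprMn sqrtr_sqr ger0_norm//.
    by rewrite mulr_ge0// ltW.
  rewrite cylE rhoE uz mulfK//; split.
    by rewrite ger_pMl//; lra.
  have -> : 1 - lc = la + lb by lra.
  have -> : (la * a + lb * b - (la + lb) * a) * (la * a + lb * b - (la + lb) * b) =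
    - (la * lb * (b - a) ^+ 2) by ring.
  by rewrite oppr_le0; exact: mulr_ge0 (mulr_ge0 la0 lb0) (sqr_ge0 _).
set u := coords _ _ _ _; rewrite cylE => -[rR uz].
have vE : vsub v O = lincomb e1 e2 n u by rewrite /u coordsK.
clearbody u.
pose lc := rho u / Rad.
have lc01 : 0 <= lc <= 1.
  by rewrite /lc divr_ge0 ?(ltW Rad0)//= ler_pdivrMr// mul1r.
rewrite -/lc in uz.
have ba : b - a != 0 by rewrite subr_eq0 eq_sym.
(* The solution of [vz u = la * a + lb * b] under [la + lb = 1 - lc]. *)
pose lb := (vz u - (1 - lc) * a) / (b - a).
pose la := 1 - lc - lb.
have lab : 0 <= la * lb.
  have -> : la * lb = - ((vz u - (1 - lc) * a) * (vz u - (1 - lc) * b)) / (b - a) ^+ 2.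
    by rewrite /la /lb; field.
  by rewrite divr_ge0// ?sqr_ge0// oppr_ge0.
have lab1 : la + lb = 1 - lc by rewrite /la; ring.
(* Two reals with nonnegative product and nonnegative sum are both nonnegative. *)
have [la0 lb0] : 0 <= la /\ 0 <= lb.
  by have /andP[] := lc01; split; rewrite leNgt; apply/negP => l0; nra.
have zE : vz u = la * a + lb * b by rewrite /la /lb; field.
have rho2 : vx u ^+ 2 + vy u ^+ 2 = (lc * Rad) ^+ 2.
  by rewrite /lc divfK// /rho sqr_sqrtr// addr_ge0// sqr_ge0.
(* The point of the circle in the direction of [u]. On the axis there is no direction and any point
   of the circle will do. *)
pose y : vec3 R := if lc == 0 then mkv Rad 0 0 else mkv (vx u / lc) (vy u / lc) 0.
have yz : vz y = 0 by rewrite /y; case: ifP.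
have y2 : dot y y = Rad ^+ 2.
  rewrite /y; case: eqP => [_|/eqP lcn0]; rewrite /dot !vxE !vyE !vzE.
    by ring.
  transitivity ((vx u ^+ 2 + vy u ^+ 2) / lc ^+ 2); first by field.
  by rewrite rho2; field.
have ux : vx u = lc * vx y.
  rewrite /y; case: eqP => [lc0|/eqP lcn0]; last first.
    by rewrite vxE; field.
  move: rho2; rewrite lc0 !mul0r expr0n/= => /eqP.
  by rewrite paddr_eq0 ?sqr_ge0// !sqrf_eq0 => /andP[/eqP].
have uy : vy u = lc * vy y.
  rewrite /y; case: eqP => [lc0|/eqP lcn0]; last first.
    by rewrite vyE; field.
  move: rho2; rewrite lc0 !mul0r expr0n/= => /eqP.
  by rewrite paddr_eq0 ?sqr_ge0// !sqrf_eq0 => /andP[_ /eqP].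
exists (vadd O (lincomb e1 e2 n y)).
  split; rewrite ?/plane /= vaddK.
    rewrite /lincomb !dotDl !dotZl e1n e2n nn yz; ring.
  by rewrite /vnorm dot_lincomb// y2 sqrtr_sqr gtr0_norm.
exists la, lb, lc; split => //; [by case/andP: lc01|by rewrite lab1; ring|].
rewrite -(vsubK O v) -[RHS](vsubK O); congr vadd; rewrite conv_coords//; last first.
  by rewrite lab1; ring.
rewrite vaddK vE -zE /lincomb yz ux uy.
by apply: vec3E; rewrite /vadd /vscale /mkv /vx /vy /vz /=; ring.
Qed.

Lemma measurable_dicone : measurable (D : set V).
Proof.
have -> : (D : set V) = (fun v : V => coords e1 e2 n (vsub v O)) @^-1` cyl.
  by apply/seteqP; split => v /diconeE.
rewrite -[X in measurable X]setTI; apply: measurable_mkv => //;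
  apply: measurable_dot => //; apply: measurable_vsub => //; exact: measurable_id.
Qed.

(** The factor [(1 - s) ^+ 2] stays because at [s = 1] the point no longer depends on [w]; only for
    [s != 1] does membership confine [w] to [[0, 1]]. *)
Lemma dicone_dicone_pt s t w : 0 <= s ->
  D (dicone_pt ((s, t), w)) <-> s <= 1 /\ (1 - s) ^+ 2 * (w * (w - 1)) <= 0.
Proof.
move=> s0; have ba : 0 < (b - a) ^+ 2 by rewrite exprn_even_gt0//= subr_eq0 eq_sym.
have vaddK (u u' : vec3 R) : vsub (vadd u u') u = u'.
  by apply: vec3E; rewrite /vsub /vadd /mkv /vx /vy /vz /=; ring.
rewrite diconeE /dicone_pt vaddK lincombK// cylE vzE /=.
have -> : rho (mkv (Rad * s * cos t) (Rad * s * sin t)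
    ((1 - s) * (b - a) * w + (1 - s) * a)) = s * Rad.
  rewrite /rho vxE vyE !exprMn -mulrDr cos2Dsin2 mulr1 -exprMn sqrtr_sqr.
  by rewrite ger0_norm ?mulr_ge0 ?(ltW Rad0)// mulrC.
rewrite mulfK ?gt_eqF// ger_pMl//.
rewrite (_ : (_ - _) * (_ - _) = (b - a) ^+ 2 * ((1 - s) ^+ 2 * (w * (w - 1)))).
  by rewrite pmulr_rle0.
by ring.
Qed.

End dicone.

(** * Change of variables on the dicone for nonnegative functions *)

Section dicone_integral.
Local Open Scope ereal_scope.
Context {R : realType}.
Local Notation mu := (@lebesgue_measure R).
Local Notation V := (R * R * R)%type.
Variables (O e1 e2 n : vec3 R) (Rad a b : R).
Hypotheses (e11 : dot e1 e1 = 1%R) (e22 : dot e2 e2 = 1%R) (nn : dot n n = 1%R).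
Hypotheses (e12 : dot e1 e2 = 0%R) (e1n : dot e1 n = 0%R) (e2n : dot e2 n = 0%R).
Hypotheses (Rad0 : (0 < Rad)%R) (ab : (a != b)%R).

Local Notation D :=
  (dicone (vadd O (vscale a n)) (vadd O (vscale b n)) (circle O n Rad) : set V).
Local Notation pt := (dicone_pt O e1 e2 n Rad a b).
Local Notation box := (@cone_dom R `*` `[0%R, 1%R]).
Local Notation jac s := (Rad ^+ 2 * `|b - a| * (s * (1 - s)))%R.

Let mD : measurable D.
Proof. exact: measurable_dicone e11 e22 nn e12 e1n e2n Rad0 ab. Qed.

Lemma measurable_cone_dom : measurable (@cone_dom R).
Proof. by apply: measurableX; exact: measurable_itv. Qed.

Lemma measurable_cone_dom_setX : measurable (box : set V).
Proof. by apply: measurableX; [exact: measurable_cone_dom|exact: measurable_itv]. Qed.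

Lemma dicone_pt_box p : box p -> D (pt p).
Proof.
move: p => [[s t] w] [[/=]]; rewrite !in_itv/= => /andP[s0 s1] _ /andP[w0 w1].
apply/dicone_dicone_pt => //; split => //.
by rewrite !mulr_ge0_le0 ?sqr_ge0 ?subr_le0.
Qed.

Let ms : measurable_fun setT (fun p : V => p.1.1).
Proof. exact: measurable_vx. Qed.

Let mt : measurable_fun setT (fun p : V => p.1.2).
Proof. exact: measurable_vy. Qed.

Lemma measurable_dicone_pt : measurable_fun setT (pt : V -> V).
Proof.
apply: measurable_vadd => //; apply: (measurableT_comp (measurable_lincomb _ _ _)).
have mRs : measurable_fun setT (fun p : V => Rad * p.1.1 : R)%R.
  exact: measurable_funM.
have m1s : measurable_fun setT (fun p : V => 1 - p.1.1 : R)%R.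
  exact: measurable_funB.
apply: measurable_mkv.
- apply: measurable_funM => //.
  exact: (measurableT_comp (continuous_measurable_fun (@continuous_cos R)) mt).
- apply: measurable_funM => //.
  exact: (measurableT_comp (continuous_measurable_fun (@continuous_sin R)) mt).
- apply: measurable_funD; last exact: measurable_funM.
  by apply: measurable_funM; [exact: measurable_funM|exact: measurable_vz].
Qed.

Variable G : V -> \bar R.
Hypotheses (mG : measurable_fun D G) (G0 : forall v, D v -> 0 <= G v).

Let g := G \_ D.

Let mg : measurable_fun setT g.
Proof. exact/(measurable_restrictT _ _).1. Qed.

Let g0 v : 0 <= g v.
Proof. by rewrite /g patchE; case: ifPn => // /set_mem/G0. Qed.

(** The absolute values keep [M] nonnegative on all of space; on [box] they drop out and the weight
    is the Jacobian. *)
Let M (p : V) : \bar R :=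
  (Rad ^+ 2 * `|b - a| * (`|p.1.1| * `|1 - p.1.1|))%:E * g (pt p).

Let M0 p : 0 <= M p.
Proof.
rewrite mule_ge0// lee_fin.
exact: mulr_ge0 (mulr_ge0 (sqr_ge0 _) (normr_ge0 _)) (mulr_ge0 _ _).
Qed.

Let mM : measurable_fun setT M.
Proof.
apply: emeasurable_funM.
  apply/measurable_EFinP; apply: measurable_funM => //; apply: measurable_funM.
    exact: measurableT_comp.
  by apply: measurableT_comp => //; exact: measurable_funB.
exact: (measurableT_comp mg measurable_dicone_pt).
Qed.

Let MQ := M \_ box.

Let mMQ : measurable_fun setT MQ.
Proof.
apply/(measurable_restrictT _ _).1; first exact: measurable_cone_dom_setX.
exact: measurable_funTS.
Qed.

Let MQ0 p : 0 <= MQ p.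
Proof. by rewrite /MQ patchE; case: ifPn. Qed.

Let h (v : V) := g (vadd O (lincomb e1 e2 n v)).

Let mh : measurable_fun setT h.
Proof.
apply: (measurableT_comp mg); apply: measurable_vadd => //.
exact: measurable_lincomb.
Qed.

Let h0 v : 0 <= h v.
Proof. exact: g0. Qed.

Let H (p : R * R) := \int[mu]_z h (p, z).

Let mH : measurable_fun setT H.
Proof. exact: (@measurable_fun_fubini_tonelli_F _ _ _ _ _ mu h). Qed.

Let H0 p : 0 <= H p.
Proof. exact: integral_ge0. Qed.

(** The vertical substitution [z = (1 - s) (b - a) w + (1 - s) a] supplies [|1 - s| |b - a|]; of the
    factors on the left, [Rad] comes from [r = Rad s] and [|Rad s|] from polar coordinates. Outside
    [box] the point has left the dicone, so [g] vanishes. *)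
Let polar_slice (s t : R) : (s != 1)%R -> (0 <= t <= 2 * pi)%R ->
  (if (0 <= s)%R then (Rad * `|Rad * s|)%:E * H (Rad * s * cos t, Rad * s * sin t)%R
   else 0) = \int[mu]_w MQ ((s, t), w).
Proof.
move=> s1 t02; case: ifPn => s0; last first.
  apply/esym/integral0_eq => w _; rewrite /MQ patchE memNset//= => -[[/=]].
  by rewrite in_itv/= (negbTE s0).
have c0 : ((1 - s) * (b - a) != 0)%R by rewrite mulf_neq0// subr_eq0 1?eq_sym.
have mhz : measurable_fun setT
    (fun z : R => h ((Rad * s * cos t, Rad * s * sin t)%R, z)).
  exact: (measurableT_comp mh (measurable_pair1 _)).
have mpw : measurable_fun setT (fun w : R => g (pt ((s, t), w))).
  exact: (measurableT_comp (measurableT_comp mg measurable_dicone_pt)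
    (measurable_pair1 _)).
rewrite /H (ge0_integral_affine ((1 - s) * a)%R c0)// muleA -EFinM.
rewrite -[LHS](@ge0_integralZl _ _ R mu _ measurableT _ mpw)//; last first.
  by rewrite lee_fin !mulr_ge0// ltW.
apply: eq_integral => w _; rewrite /MQ patchE /M /=.
have [_|/negP sw] := boolP (_ \in _).
  congr (_%:E * _); rewrite !normrM (gtr0_norm Rad0); ring.
rewrite /g patchE memNset ?mule0// => ptD.
have [s1' sw'] := (dicone_dicone_pt O e11 e22 nn e12 e1n e2n Rad0 ab t w s0).1 ptD.
apply: sw; apply/mem_set; split; [split|] => /=; rewrite in_itv/= ?s0//.
have s2 : (0 < (1 - s) ^+ 2)%R by rewrite exprn_even_gt0//= subr_eq0 eq_sym.
by move: sw'; rewrite pmulr_rle0// => sw'; apply/andP; split; nra.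
Qed.

Lemma ge0_integral_dicone : \int[lebesgue3]_(v in D) G v =
  \int[lebesgue3]_(p in box) ((jac p.1.1)%:E * G (pt p)).
Proof.
have -> : \int[lebesgue3]_(p in box) ((jac p.1.1)%:E * G (pt p)) =
    \int[lebesgue3]_p MQ p.
  rewrite integral_mkcond; apply: eq_integral => p _; rewrite /MQ !patchE.
  case: ifPn => // /set_mem pbox; rewrite /M /g patchE mem_set; last first.
    exact: dicone_pt_box.
  move: pbox => [[/=]]; rewrite in_itv/= => /andP[s0 s1] _ _.
  by rewrite (ger0_norm s0) (@ger0_norm _ (1 - p.1.1))%R ?subr_ge0.
rewrite integral_mkcond -/g.
rewrite -(ge0_integral_isometry e11 e22 nn e12 e1n e2n O mg g0).
transitivity (\int[lebesgue2]_p H p).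
  exact: (@fubini_tonelli1 _ _ _ _ R lebesgue2 mu h).
transitivity (\int[mu]_(t in `[0%R, (2 * pi)%R])
    \int[mu]_(r in `[0%R, +oo[) (r%:E * H (r * cos t, r * sin t)%R)).
  exact: ge0_integral_polar.
transitivity (\int[lebesgue2]_p \int[mu]_w MQ (p, w)); last first.
  by apply/esym; exact: (@fubini_tonelli1 _ _ _ _ R lebesgue2 mu MQ).
pose N (p : R * R) := \int[mu]_w MQ (p, w).
have mN : measurable_fun setT N.
  exact: (@measurable_fun_fubini_tonelli_F _ _ _ _ _ mu MQ).
have N0 p : 0 <= N p by exact: integral_ge0.
transitivity (\int[mu]_t \int[mu]_s N (s, t)); last first.
  by apply/esym; exact: (@fubini_tonelli2 _ _ _ _ R mu mu N).
rewrite integral_mkcond; apply: eq_integral => t _; rewrite patchE.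
case: ifPn => [/set_mem/=|tI]; last first.
  apply/esym/integral0_eq => s _; apply: integral0_eq => w _.
  rewrite /MQ patchE memNset// => -[[_ /= t02] _]; move/negP: tI; apply.
  exact/mem_set.
rewrite in_itv/= => t02.
pose F (r : R) := `|r|%:E * H (r * cos t, r * sin t)%R.
have F0 r : 0 <= F r by rewrite mule_ge0.
have mF : measurable_fun setT F.
  apply: emeasurable_funM; first by apply/measurable_EFinP; exact: normr_measurable.
  apply: (measurableT_comp mH); apply/measurable_fun_pairP.
  by split; exact: measurable_funM.
transitivity (\int[mu]_(r in `[0%R, +oo[) F r).
  apply: eq_integral => r /set_mem/=; rewrite in_itv/= andbT => r0.
  by rewrite /F ger0_norm.
have Rn0 : (Rad != 0)%R by rewrite gt_eqF.
rewrite (ge0_integral_affine_in 0 Rn0)//.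
have -> : (fun x => Rad * x + 0)%R @^-1` `[0%R, +oo[%classic = `[0%R, +oo[%classic.
  by apply/seteqP; split => x /=; rewrite !in_itv/= !andbT addr0 pmulr_rge0.
have mFa : measurable_fun setT (fun s : R => F (Rad * s + 0)%R).
  by apply: (measurableT_comp mF); exact: measurable_affine.
rewrite -(@ge0_integralZl _ _ R mu _ (measurable_itv _) _ (measurable_funTS mFa))//.
rewrite integral_mkcond; apply: ge0_ae_eq_integral => //.
- apply/(measurable_restrictT _ _).1; first exact: measurable_itv.
  by apply: measurable_funTS; exact: measurable_funeM.
- exact: (measurableT_comp mN (measurable_pair2 t)).
- by move=> s _; rewrite patchE; case: ifPn => // _; rewrite mule_ge0.
(* At [s = 1] the vertical substitution has slope [0]; this radius is a null set. *)
exists [set 1%R]; split => //; first exact: lebesgue_measure_set1.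
move=> s /=; apply: contra_notP => /eqP s1 _;
have -> : N (s, t) = _ := esym (polar_slice s1 t02).
rewrite patchE.
have -> : (s \in `[0%R, +oo[%classic) = (0 <= s)%R.
  by apply/idP/idP => [/set_mem/=|s0]; [|apply/mem_set => /=]; rewrite in_itv/= andbT.
by case: ifPn => // _; rewrite /F addr0 muleA EFinM gtr0_norm.
Qed.

End dicone_integral.

(** * The weighted inequality for convex functions on the unit interval *)

Section convex_weight.
Context {R : realType}.
Local Notation mu := (@lebesgue_measure R).
Local Notation q s := (1 - 6 * (s * (1 - s))).

Lemma integral_cubic (c0 c1 c2 c3 : R) :
  (\int[mu]_(s in `[0%R, 1%R]) (c0 + c1 * s + c2 * s ^+ 2 + c3 * s ^+ 3)%:E =
   (c0 + c1 / 2 + c2 / 3 + c3 / 4)%:E)%E.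
Proof.
pose F (s : R) := c0 * s + c1 / 2 * s ^+ 2 + c2 / 3 * s ^+ 3 + c3 / 4 * s ^+ 4.
have dF (s : R) : is_derive s 1 F (c0 + c1 * s + c2 * s ^+ 2 + c3 * s ^+ 3).
  by apply: is_derive_eq; rewrite /GRing.scale/=; field.
have cF : continuous F by move=> s; apply/differentiable_continuous/derivable1_diffP.
rewrite (@continuous_FTC2 _ _ F).
- by rewrite -EFinB; congr EFin; rewrite /F !expr1n !expr0n/=; ring.
- exact: ltr01.
- apply: continuous_subspaceT => s; apply/differentiable_continuous.
  exact/derivable1_diffP.
- split.
  + by move=> s _; have [] := dF s.
  + by apply: cvg_at_right_filter; exact: cF.
  + by apply: cvg_at_left_filter; exact: cF.
- by move=> s _; rewrite derive1E; have [_ ->] := dF s.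
Qed.

Variable h : R -> R.
Hypothesis convh : forall x y l, 0 <= x <= 1 -> 0 <= y <= 1 -> 0 <= l <= 1 ->
  h (l * x + (1 - l) * y) <= l * h x + (1 - l) * h y.

(** Chosen so that [(1 - r) / 2] and [(1 + r) / 2] are the roots of [1 - 6 s (1 - s)], the two
    Gauss-Legendre nodes of [[0, 1]]. *)
Let r : R := Num.sqrt 3^-1.

Let r2 : r ^+ 2 = 3^-1. Proof. by rewrite sqr_sqrtr// invr_ge0. Qed.

Let r01 : 0 < r < 1.
Proof.
have r0 : 0 < r by rewrite sqrtr_gt0 invr_gt0.
by rewrite r0 /=; have := r2; nra.
Qed.

Let chord s := (h ((1 - r) / 2) * ((1 + r) / 2 - s) +
  h ((1 + r) / 2) * (s - (1 - r) / 2)) / r.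

(* [q] vanishes at [s0] and [s1] and is negative exactly between them, where the
   convex [h] lies below its chord through [s0] and [s1]; elsewhere it is above. *)
Let weight_chord s : 0 <= s <= 1 -> q s * chord s <= q s * h s.
Proof.
have /andP[r0 r1] := r01; rewrite /chord.
set s0 := (1 - r) / 2; set s1 := (1 + r) / 2 => s01.
have qE : q s = 6 * ((s - s0) * (s - s1)).
  have -> : q s = 6 * ((s - s0) * (s - s1)) + (3 * r ^+ 2 - 1) / 2.
    by rewrite /s0 /s1; field.
  by rewrite r2; field.
have s0i : 0 <= s0 <= 1 by rewrite /s0; apply/andP; split; lra.
have s1i : 0 <= s1 <= 1 by rewrite /s1; apply/andP; split; lra.
have s10 : s1 - s0 = r by rewrite /s1 /s0; field.
have rn0 : r != 0 by rewrite gt_eqF.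
rewrite -subr_ge0 -mulrBr -(pmulr_rge0 _ r0) mulrCA.
have -> : r * (h s - (h s0 * (s1 - s) + h s1 * (s - s0)) / r) =
    r * h s - (h s0 * (s1 - s) + h s1 * (s - s0)) by field.
(* In each of the three positions of [s], convexity is applied at the middle one of [s], [s0], [s1],
   written as a combination of the outer two, and the denominator is then cleared. *)
clearbody s0 s1; have [ss0|ss0] := ltP s s0.
  have l0 : 0 < s1 - s by lra.
  have l01 : 0 <= r / (s1 - s) <= 1.
    by rewrite divr_ge0 ?(ltW r0) ?(ltW l0)//= ler_pdivrMr// mul1r; lra.
  have := convh s01 s1i l01.
  have -> : r / (s1 - s) * s + (1 - r / (s1 - s)) * s1 = s0.
    by rewrite -s10; field; rewrite gt_eqF.
  rewrite -(ler_pM2r l0) [leRHS]mulrDl (mulrAC _ (h s)) divfK ?gt_eqF//.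
  rewrite (mulrAC (1 - _)) (mulrBl _ 1) mul1r divfK ?gt_eqF// => hs.
  rewrite qE mulr_ge0//; last by nra.
  by rewrite mulr_ge0// mulr_le0//; lra.
have [ss1|ss1] := leP s s1.
  have l01 : 0 <= (s1 - s) / r <= 1.
    by rewrite divr_ge0 ?(ltW r0) ?subr_ge0//= ler_pdivrMr// mul1r; lra.
  have := convh s0i s1i l01.
  have -> : (s1 - s) / r * s0 + (1 - (s1 - s) / r) * s1 = s.
    by rewrite -s10; field; rewrite s10.
  rewrite -(ler_pM2r r0) [leRHS]mulrDl (mulrAC _ (h s0)) divfK//.
  rewrite (mulrAC (1 - _)) (mulrBl _ 1) mul1r divfK// => hs.
  rewrite qE mulr_le0//; last by nra.
  by rewrite mulr_ge0_le0// mulr_ge0_le0 ?subr_ge0 ?subr_le0.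
have l0 : 0 < s - s0 by lra.
have l01 : 0 <= (s - s1) / (s - s0) <= 1.
  by rewrite divr_ge0 ?(ltW l0) ?subr_ge0 ?(ltW ss1)//= ler_pdivrMr// mul1r; lra.
have := convh s0i s01 l01.
have -> : (s - s1) / (s - s0) * s0 + (1 - (s - s1) / (s - s0)) * s = s1.
  by field; rewrite gt_eqF.
rewrite -(ler_pM2r l0) [leRHS]mulrDl (mulrAC _ (h s0)) divfK ?gt_eqF//.
rewrite (mulrAC (1 - _)) (mulrBl _ 1) mul1r divfK ?gt_eqF// => hs.
rewrite qE mulr_ge0//; last by nra.
by rewrite mulr_ge0// mulr_ge0//; lra.
Qed.

(** The endpoint values bound [h] from above; the midpoint [1 / 2] of [s] and [1 - s] then bounds it
    from below by [2 h(1/2) - h(1 - s)]. Together with measurability this yields integrability. *)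
Let h_bounded s : 0 <= s <= 1 -> `|h s| <= 2 * `|h 2^-1| + `|h 0| + `|h 1|.
Proof.
have i0 : (0 : R) <= (0 : R) <= (1 : R) by apply/andP; split; lra.
have i1 : (0 : R) <= (1 : R) <= (1 : R) by apply/andP; split; lra.
have ub x : 0 <= x <= 1 -> h x <= `|h 0| + `|h 1|.
  move=> x01; have := convh i1 i0 x01; rewrite mulr1 mulr0 addr0.
  move=> /le_trans; apply; move/andP: x01 => [x0 x1].
  have := ler_norm (h 0); have := ler_norm (h 1).
  have := normr_ge0 (h 0); have := normr_ge0 (h 1); nra.
move=> s01; have s01' : 0 <= 1 - s <= 1 by move/andP: s01 => []; lra.
have half : (0 : R) <= (2^-1 : R) <= (1 : R) by apply/andP; split; lra.
have := convh s01 s01' half.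
have -> : 2^-1 * s + (1 - 2^-1) * (1 - s) = 2^-1 by field.
have := ub _ s01; have := ub _ s01'; have := ler_norm (- h 2^-1); rewrite normrN.
have := normr_ge0 (h 2^-1).
by rewrite ler_norml => *; apply/andP; split; lra.
Qed.

Hypothesis mh : measurable_fun (`]0, 1] : set R) h.

(** Pointwise comparison with the weighted chord, whose integral is [0] by orthogonality. The point
    [0] is left out because the functions on the cones are set to [0] there. *)
Lemma convex_weight_integral_ge0 :
  (0 <= \int[mu]_(s in `]0%R, 1%R]) (q s * h s)%:E)%E.
Proof.
(* [c0 + c1 * s] is [chord s], and [P] is its product with the weight, expanded into a cubic. *)
pose c0 := (h ((1 - r) / 2) * ((1 + r) / 2) - h ((1 + r) / 2) * ((1 - r) / 2)) / r.
pose c1 := (h ((1 + r) / 2) - h ((1 - r) / 2)) / r.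
pose P (s : R) := c0 + (c1 - 6 * c0) * s + (6 * c0 - 6 * c1) * s ^+ 2 +
  (6 * c1) * s ^+ 3.
have PE s : P s = q s * chord s.
  have /andP[rpos _] := r01.
  by rewrite /P /c0 /c1 /chord; field; rewrite gt_eqF.
have cP : continuous P.
  move=> s; apply: cvgD; last by apply: cvgM; [exact: cvg_cst|exact: exprn_continuous].
  apply: cvgD; last by apply: cvgM; [exact: cvg_cst|exact: exprn_continuous].
  by apply: cvgD; [exact: cvg_cst|apply: cvgM; [exact: cvg_cst|exact: cvg_id]].
have mP : measurable_fun setT P by exact: continuous_measurable_fun.
have P0 : (\int[mu]_(s in `]0%R, 1%R]) (P s)%:E = 0)%E.
  rewrite integral_itv_obnd_cbnd; last by apply/measurable_EFinP; exact: measurable_funTS.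
  by rewrite integral_cubic; congr EFin; field.
rewrite -P0; apply: le_integral => //.
- apply: (@integrableS _ _ _ mu `[0%R, 1%R]) => //.
    by apply: subset_itv_oc_cc.
  apply: continuous_compact_integrable; first exact: segment_compact.
  exact: continuous_subspaceT.
- apply: (@measurable_bounded_integrable _ _ _ mu (fun s => q s * h s)) => //.
  + by rewrite [X in (X < _)%E]lebesgue_measure_itv/= lte_fin ltr01 -EFinB ltry.
  + apply: measurable_funM => //; apply: measurable_funTS.
    apply: measurable_funB => //; apply: measurable_funM => //.
    by apply: measurable_funM => //; exact: measurable_funB.
  + exists (2 * `|h 2^-1| + `|h 0| + `|h 1|); split; first exact: num_real.
    move=> M ltM s /=; rewrite in_itv/= => /andP[s0 s1].
    have s01 : 0 <= s <= 1 by rewrite (ltW s0).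
    rewrite normrM (le_trans _ (ltW ltM))// (le_trans _ (h_bounded s01))//.
    by rewrite ler_piMl// ler_norml; apply/andP; split; nra.
- move=> s /set_mem/=; rewrite in_itv/= => /andP[s0 s1].
  by rewrite lee_fin PE weight_chord// (ltW s0).
Qed.

End convex_weight.

(** * Integrals of products of functions of separate variables *)

Section product_integrals.
Local Open Scope ereal_scope.
Context d1 d2 (T1 : measurableType d1) (T2 : measurableType d2) (R : realType).
Variables (m1 : {sigma_finite_measure set T1 -> \bar R})
  (m2 : {sigma_finite_measure set T2 -> \bar R}) (A : set T1) (B : set T2).
Variables (u : T1 -> R) (v : T2 -> R).
Hypotheses (mA : measurable A) (mB : measurable B).
Hypotheses (iu : m1.-integrable A (EFin \o u)) (iv : m2.-integrable B (EFin \o v)).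

Let uA := u \_ A.
Let vB := v \_ B.

Let iuA : m1.-integrable setT (EFin \o uA).
Proof. by have := (integrable_mkcond _ mA).1 iu; rewrite restrict_EFin. Qed.

Let ivB : m2.-integrable setT (EFin \o vB).
Proof. by have := (integrable_mkcond _ mB).1 iv; rewrite restrict_EFin. Qed.

Let uv (p : T1 * T2) := (uA p.1 * vB p.2)%:E.

Let uvE : (fun p => (u p.1 * v p.2)%:E) \_ (A `*` B) = uv.
Proof.
apply/funext => -[x y]; rewrite /uv /uA /vB !patchE in_setX /=.
by case: (x \in A); case: (y \in B); rewrite ?mulr0 ?mul0r.
Qed.

Let muv : measurable_fun setT uv.
Proof.
apply/measurable_EFinP; apply: measurable_funM.
  apply: measurableT_comp measurable_fst.
  by have /measurable_EFinP := measurable_int _ iuA.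
apply: measurableT_comp measurable_snd.
by have /measurable_EFinP := measurable_int _ ivB.
Qed.

Let iuv : (m1 \x m2).-integrable setT uv.
Proof.
apply/(integrable12ltyP _ _ muv).
have /integrableP[mu1 u1] := iuA; have /integrableP[mv1 v1] := ivB.
have uE x : \int[m2]_y `|uv (x, y)| = `|uA x|%:E * \int[m2]_y `|(vB y)%:E|.
  rewrite -ge0_integralZl//; last exact: measurableT_comp.
  by apply: eq_integral => y _; rewrite /uv /= normrM EFinM.
under eq_integral do rewrite uE.
rewrite ge0_integralZr//; last 2 first.
- exact: (measurableT_comp (@abse_measurable R setT) mu1).
- exact: integral_ge0.
by rewrite lte_mul_pinfty ?integral_ge0// ge0_fin_numE ?integral_ge0.
Qed.

Lemma integrable_setX_mul :
  (m1 \x m2).-integrable (A `*` B) (fun p => (u p.1 * v p.2)%:E).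
Proof. by apply/integrable_mkcond; [exact: measurableX|rewrite uvE]. Qed.

Lemma integral_setX_mul :
  \int[m1 \x m2]_(p in A `*` B) (u p.1 * v p.2)%:E =
  \int[m1]_(x in A) (u x)%:E * \int[m2]_(y in B) (v y)%:E.
Proof.
rewrite integral_mkcond uvE -integral12_prod_meas1//.
have -> : \int[m1]_(x in A) (u x)%:E = \int[m1]_x (uA x)%:E.
  by rewrite integral_mkcond restrict_EFin.
have -> : \int[m2]_(y in B) (v y)%:E = \int[m2]_y (vB y)%:E.
  by rewrite integral_mkcond restrict_EFin.
have vfin : \int[m2]_y (vB y)%:E \is a fin_num by exact: integrable_fin_num.
transitivity (\int[m1]_x ((fine (\int[m2]_y (vB y)%:E))%:E * (uA x)%:E)).
  apply: eq_integral => x _; rewrite fineK// muleC /fubini_F /uv /=.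
  by under eq_integral do rewrite EFinM; rewrite integralZl.
by rewrite integralZl// fineK// muleC.
Qed.

End product_integrals.

(** * Positivity of integrals over the cone parameters, slice by slice *)

Section cone_domain_weight.
Local Open Scope ereal_scope.
Context {R : realType}.
Local Notation mu := (@lebesgue_measure R).

(** The integrand may change sign, so this is Fubini for integrable functions, with [s] innermost:
    only the integral over each generator has to be nonnegative. *)
Lemma cone_dom_integral_ge0 (k : R * R -> R) :
  lebesgue2.-integrable (@cone_dom R) (EFin \o k) ->
  (forall t, (0 <= t <= 2 * pi)%R ->
    0 <= \int[mu]_(s in `[0%R, 1%R]) (k (s, t))%:E) ->
  0 <= \int[lebesgue2]_(p in @cone_dom R) (k p)%:E.
Proof.
move=> ik k0; have ik' : lebesgue2.-integrable setT ((EFin \o k) \_ @cone_dom R).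
  by apply: (iffLR (integrable_mkcond _ _)) ik; exact: measurable_cone_dom.
rewrite integral_mkcond -(@integral21_prod_meas1 _ _ _ _ R mu mu _ ik').
apply: integral_ge0 => t _; rewrite /fubini_G.
have [t02|/negP t02] := boolP (0 <= t <= 2 * pi)%R.
  rewrite (_ : \int[_]_x _ = \int[mu]_(s in `[0%R, 1%R]) (k (s, t))%:E); first exact: k0.
  rewrite [RHS]integral_mkcond; apply: eq_integral => s _; rewrite !patchE.
  by rewrite in_setX/= [X in _ && X]mem_set ?andbT//= in_itv.
rewrite integral0_eq// => s _; rewrite patchE memNset// => -[_ /=].
by rewrite in_itv.
Qed.

End cone_domain_weight.

(** * Area element and distance to the axis on a cone *)

Section lateral_surface.
Context {R : realType}.
Variables (O e1 e2 n : vec3 R) (Rad c : R).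
Hypotheses (e11 : dot e1 e1 = 1) (e22 : dot e2 e2 = 1) (nn : dot n n = 1).
Hypotheses (e12 : dot e1 e2 = 0) (e1n : dot e1 n = 0) (e2n : dot e2 n = 0).
Hypothesis Rad0 : 0 < Rad.

Let P := vadd O (vscale c n).

(** Lagrange's identity: the area element is the square root of a Gram determinant. *)
Lemma dot_cross (u v : vec3 R) :
  dot (cross u v) (cross u v) = dot u u * dot v v - dot u v ^+ 2.
Proof. by rewrite /dot /cross /mkv /vx /vy /vz /=; ring. Qed.

Lemma dpar_s_cone s t :
  dpar_s (cone_param P O e1 e2 Rad) s t = vsub (circ_pt O e1 e2 Rad t) P.
Proof.
have dE (x y : R) : derive1 (fun u : R => x + u * y) s = y.
  rewrite derive1E; apply: derive_val; apply: is_derive_eq.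
  by rewrite /GRing.scale /=; ring.
by rewrite /dpar_s; apply: vec3E; rewrite /vx /vy /vz /= dE.
Qed.

Lemma dpar_t_cone s t : dpar_t (cone_param P O e1 e2 Rad) s t =
  vscale (s * Rad) (vadd (vscale (- sin t) e1) (vscale (cos t) e2)).
Proof.
have dE (p o x y : R) :
    derive1 (fun u : R => p + s * (o + (Rad * cos u * x + Rad * sin u * y) - p)) t =
    s * Rad * (- sin t * x + cos t * y).
  rewrite derive1E; apply: derive_val; apply: is_derive_eq.
  by rewrite /GRing.scale /=; ring.
by rewrite /dpar_t; apply: vec3E; rewrite /vx /vy /vz /= dE.
Qed.

(** The generator, of length the slant height, is orthogonal to the circular tangent, of length
    [s * Rad]; the Gram determinant is the product of the squares. *)
Lemma area_elt_cone s t : 0 <= s ->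
  area_elt (cone_param P O e1 e2 Rad) s t = s * Rad * Num.sqrt (Rad ^+ 2 + c ^+ 2).
Proof.
move=> s0; rewrite /area_elt dpar_s_cone dpar_t_cone /vnorm dot_cross.
have -> : vsub (circ_pt O e1 e2 Rad t) P =
    vadd (vadd (vscale (Rad * cos t) e1) (vscale (Rad * sin t) e2)) (vscale (- c) n).
  by apply: vec3E; rewrite /P /circ_pt /vsub /vadd /vscale /mkv /vx /vy /vz /=; ring.
rewrite !(dotDl, dotZl, dotDr, dotZr) !(dotC e2 e1, dotC n).
rewrite e11 e22 nn e12 e1n e2n.
have cs := cos2Dsin2 t.
rewrite (_ : _ - _ = (s * Rad) ^+ 2 * (Rad ^+ 2 + c ^+ 2)).
  rewrite sqrtrM ?sqr_ge0// sqrtr_sqr ger0_norm// mulr_ge0// ltW//.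
transitivity ((Rad ^+ 2 * (cos t ^+ 2 + sin t ^+ 2) + c ^+ 2) *
  ((s * Rad) ^+ 2 * (cos t ^+ 2 + sin t ^+ 2))); first by ring.
by rewrite cs; ring.
Qed.

(** By Pythagoras the infimum is attained at the orthogonal projection to the axis, at height
    [(1 - s) * c]. *)
Lemma dist_line_cone s t : 0 <= s ->
  dist_line (cone_param P O e1 e2 Rad s t) O n = Rad * s.
Proof.
move=> s0; rewrite /P cone_paramE.
have dE z : vnorm (vsub (vadd O (lincomb e1 e2 n (mkv (Rad * s * cos t)
      (Rad * s * sin t) ((1 - s) * c)))) (vadd O (vscale z n))) =
    Num.sqrt ((Rad * s) ^+ 2 + ((1 - s) * c - z) ^+ 2).
  rewrite (_ : vsub _ _ = lincomb e1 e2 n (mkv (Rad * s * cos t)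
    (Rad * s * sin t) ((1 - s) * c - z))); last first.
    by apply: vec3E; rewrite /lincomb /vsub /vadd /vscale /mkv /vx /vy /vz /=; ring.
  rewrite /vnorm dot_lincomb//; congr Num.sqrt; rewrite /dot /mkv /vx /vy /vz /=.
  transitivity ((Rad * s) ^+ 2 * (cos t ^+ 2 + sin t ^+ 2) + ((1 - s) * c - z) ^+ 2).
    by ring.
  by rewrite cos2Dsin2 mulr1.
have Rs0 : 0 <= Rad * s by rewrite mulr_ge0// ltW.
apply/eqP; rewrite eq_le; apply/andP; split.
  apply: ge_inf; first by exists 0 => _ [z _ <-]; exact: vnorm_ge0.
  by exists ((1 - s) * c) => //; rewrite dE subrr expr0n addr0 sqrtr_sqr ger0_norm.
apply: lb_le_inf; first by eexists; exists 0.
move=> _ [z _ <-]; rewrite dE -[leLHS](ger0_norm Rs0) -sqrtr_sqr ler_wsqrtr//.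
by rewrite lerDl sqr_ge0.
Qed.

End lateral_surface.

(** * Change of variables on the dicone for integrable functions *)

Section dicone_integrable.
Local Open Scope ereal_scope.
Context {R : realType}.
Local Notation V := (R * R * R)%type.
Variables (O e1 e2 n : vec3 R) (Rad a b : R).
Hypotheses (e11 : dot e1 e1 = 1%R) (e22 : dot e2 e2 = 1%R) (nn : dot n n = 1%R).
Hypotheses (e12 : dot e1 e2 = 0%R) (e1n : dot e1 n = 0%R) (e2n : dot e2 n = 0%R).
Hypotheses (Rad0 : (0 < Rad)%R) (ab : (a != b)%R).

Local Notation D :=
  (dicone (vadd O (vscale a n)) (vadd O (vscale b n)) (circle O n Rad) : set V).
Local Notation pt := (dicone_pt O e1 e2 n Rad a b).
Local Notation box := (@cone_dom R `*` `[0%R, 1%R]).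
Local Notation jac s := (Rad ^+ 2 * `|b - a| * (s * (1 - s)))%R.

Variable f : V -> R.
Hypothesis intf : lebesgue3.-integrable D (EFin \o f).

Let mf : measurable_fun D (EFin \o f).
Proof. exact: measurable_int intf. Qed.

Let cov (G : V -> \bar R) : measurable_fun D G -> (forall v, D v -> 0 <= G v) ->
  \int[lebesgue3]_(v in D) G v =
  \int[lebesgue3]_(p in box) ((jac p.1.1)%:E * G (pt p)).
Proof. exact: ge0_integral_dicone. Qed.

Let jac_ge0 (p : V) : box p -> (0 <= jac p.1.1)%R.
Proof.
move=> [[/=]]; rewrite in_itv/= => /andP[s0 s1] _ _.
apply: mulr_ge0 (mulr_ge0 (sqr_ge0 _) (normr_ge0 _)) (mulr_ge0 s0 _).
by rewrite subr_ge0.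
Qed.

Let mpsi : measurable_fun (box : set V)
  (fun p : V => (jac p.1.1 * f (pt p))%:E : \bar R).
Proof.
apply/measurable_EFinP; apply: measurable_funM.
  apply: measurable_funTS; apply: measurable_funM => //.
  apply: measurable_funM; first exact: measurable_vx.
  by apply: measurable_funB => //; exact: measurable_vx.
have mD : measurable D by exact: measurable_dicone e11 e22 nn e12 e1n e2n Rad0 ab.
have ptD : (pt : V -> V) @` box `<=` D by move=> _ [p pbox <-]; exact: dicone_pt_box.
have mfD : measurable_fun D f by exact/measurable_EFinP.
have mpt : measurable_fun (box : set V) (pt : V -> V).
  by apply: measurable_funTS; exact: measurable_dicone_pt.
exact: (measurable_comp mD ptD mfD mpt).
Qed.

Lemma integrable_dicone :
  lebesgue3.-integrable box (fun p => (jac p.1.1 * f (pt p))%:E).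
Proof.
apply/integrableP; split; first exact: mpsi.
have /integrableP[_] := intf.
rewrite cov//; last exact: measurableT_comp.
apply: le_lt_trans; rewrite le_eqVlt; apply/orP; left; apply/eqP.
apply: eq_integral => p /set_mem/jac_ge0 jp.
by rewrite /= normrM EFinM ger0_norm.
Qed.

(** The nonnegative formula is applied to the positive and negative parts of [f], which commute with
    multiplication by the nonnegative Jacobian. *)
Lemma integral_dicone : \int[lebesgue3]_(v in D) (f v)%:E =
  \int[lebesgue3]_(p in box) (jac p.1.1 * f (pt p))%:E.
Proof.
rewrite integralE [RHS]integralE; congr (_ - _).
- rewrite cov//; last exact: measurable_funepos.
  apply: eq_integral => p /set_mem/jac_ge0 jp.
  by rewrite !funeposE /= -!EFin_max -EFinM maxr_pMr// mulr0.
- rewrite cov//; last exact: measurable_funeneg.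
  apply: eq_integral => p /set_mem/jac_ge0 jp.
  by rewrite !funenegE /= -!EFin_max -EFinM maxr_pMr// mulr0 mulrN.
Qed.

End dicone_integrable.

(** * Weighted integrals over the cone parameters *)

Section cone_domain_integrals.
Local Open Scope ereal_scope.
Context {R : realType}.
Local Notation mu := (@lebesgue_measure R).

Lemma integrable_cone_dom_mul (w : R -> R) (k : R * R -> R) :
  measurable_fun setT w -> (forall s, (0 <= s <= 1)%R -> (`|w s| <= 1)%R) ->
  lebesgue2.-integrable (@cone_dom R) (EFin \o k) ->
  lebesgue2.-integrable (@cone_dom R) (fun p => (w p.1 * k p)%:E).
Proof.
move=> mw w1 ik; apply: (le_integrable _ _ _ ik).
- exact: measurable_cone_dom.
- have /measurable_EFinP mk := measurable_int _ ik.
  apply/measurable_EFinP; apply: measurable_funM => //.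
  by apply: measurable_funTS; exact: (measurableT_comp mw measurable_fst).
- move=> p [/= p1 _]; rewrite in_itv/= in p1.
  by rewrite lee_fin normrM ler_piMl// w1.
Qed.

Lemma integral_cone_dom_fst (w : R -> R) : continuous w ->
  lebesgue2.-integrable (@cone_dom R) (fun p => (w p.1)%:E) /\
  \int[lebesgue2]_(p in @cone_dom R) (w p.1)%:E =
  \int[mu]_(s in `[0%R, 1%R]) (w s)%:E * (2 * pi)%:E.
Proof.
move=> cw; have pi0 := pi_ge0 R.
have iw : mu.-integrable `[0%R, 1%R] (EFin \o w).
  apply: continuous_compact_integrable; first exact: segment_compact.
  exact: continuous_subspaceT.
have i1 : mu.-integrable `[0%R, (2 * pi)%R] (EFin \o cst 1%R).
  apply: continuous_compact_integrable; first exact: segment_compact.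
  by apply: continuous_subspaceT; exact: cst_continuous.
have wE : (fun p : R * R => (w p.1 * cst 1 p.2)%:E) = (fun p => (w p.1)%:E).
  by apply/funext => p /=; rewrite mulr1.
split.
  have := @integrable_setX_mul _ _ _ _ R mu mu _ _ w (cst 1%R)
    (measurable_itv _) (measurable_itv _) iw i1.
  by rewrite wE.
have := @integral_setX_mul _ _ _ _ R mu mu _ _ w (cst 1%R)
  (measurable_itv _) (measurable_itv _) iw i1.
rewrite wE => ->; congr (_ * _); rewrite /= integral_cst// mul1e.
rewrite [LHS]lebesgue_measure_itv/= lte_fin; case: ltP => [_|pi_le].
  by rewrite -EFinB subr0.
by congr EFin; lra.
Qed.

(* [h] is replaced by [0] on [s = 0], where the integrand over the lateral
   surface is [0] by the convention [x / 0 = 0]. *)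
Lemma cone_dom_convex_weight (h : R -> R -> R) :
  (forall t x y l, (0 <= t <= 2 * pi)%R ->
    (0 <= x <= 1)%R -> (0 <= y <= 1)%R -> (0 <= l <= 1)%R ->
    (h (l * x + (1 - l) * y) t <= l * h x t + (1 - l) * h y t)%R) ->
  let k := fun p : R * R => if p.1 == 0%R then 0%R else h p.1 p.2 in
  lebesgue2.-integrable (@cone_dom R) (EFin \o k) ->
  6%:E * \int[lebesgue2]_(p in @cone_dom R) (p.1 * (1 - p.1) * k p)%:E <=
  \int[lebesgue2]_(p in @cone_dom R) (k p)%:E.
Proof.
move=> convh k ik.
have mw : measurable_fun setT (fun s : R => s * (1 - s))%R.
  by apply: measurable_funM => //; exact: measurable_funB.
have iwk : lebesgue2.-integrable (@cone_dom R) (fun p => (p.1 * (1 - p.1) * k p)%:E).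
  apply: (integrable_cone_dom_mul (w := fun s => s * (1 - s))%R) => // s /andP[s0 s1].
  by rewrite ler_norml; apply/andP; split; nra.
have mq : measurable_fun setT (fun s : R => 1 - 6 * (s * (1 - s)))%R.
  by apply: measurable_funB => //; exact: measurable_funM.
have iqk : lebesgue2.-integrable (@cone_dom R)
    (fun p => ((1 - 6 * (p.1 * (1 - p.1))) * k p)%:E).
  apply: (integrable_cone_dom_mul (w := fun s => 1 - 6 * (s * (1 - s)))%R) => //.
  by move=> s /andP[s0 s1]; rewrite ler_norml; apply/andP; split; nra.
have mC : measurable (@cone_dom R) by exact: measurable_cone_dom.
(* The difference of the two sides of the claim is the integral of [k] against [1 - 6 s (1 - s)],
   which is then shown to be nonnegative. *)
have -> : \int[lebesgue2]_(p in @cone_dom R) (k p)%:E =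
    \int[lebesgue2]_(p in @cone_dom R) ((1 - 6 * (p.1 * (1 - p.1))) * k p)%:E +
    6%:E * \int[lebesgue2]_(p in @cone_dom R) (p.1 * (1 - p.1) * k p)%:E.
  rewrite -integralZl// -integralD//; last exact: integrableZl.
  by apply: eq_integral => p _; rewrite -EFinM -EFinD; congr EFin; ring.
rewrite leeDr//.
apply: (cone_dom_integral_ge0 (k := fun p => (1 - 6 * (p.1 * (1 - p.1))) * k p)%R) => //.
move=> t t02.
have mk : measurable_fun (`]0%R, 1%R] : set R) (fun s => k (s, t)).
  have /measurable_EFinP mk := measurable_int _ ik.
  have mk' : measurable_fun setT (k \_ @cone_dom R).
    by apply: (iffLR (measurable_restrictT _ _)); [exact: mC|exact: mk].
  have mkt : measurable_fun setT (fun s : R => (k \_ @cone_dom R) (s, t)).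
    exact: (measurableT_comp mk' (measurable_pair2 t)).
  apply: eq_measurable_fun (measurable_funTS mkt).
  move=> s /set_mem/=; rewrite in_itv/= => /andP[s0 s1].
  by rewrite patchE mem_set//; split; rewrite /= in_itv/= ?(ltW s0).
(* Dropping the null point [s = 0] lets the convex [h] take the place of [k]. *)
rewrite -integral_itv_obnd_cbnd; last first.
  by apply/measurable_EFinP; apply: measurable_funM => //; exact: measurable_funTS.
have kE s : `]0%R, 1%R]%classic s -> k (s, t) = h s t.
  by rewrite /k /= in_itv/= => /andP[s0 _]; rewrite gt_eqF.
have mh : measurable_fun (`]0%R, 1%R] : set R) (h ^~ t).
  by apply: eq_measurable_fun mk => s /set_mem/kE.
have := convex_weight_integral_ge0 (fun x y l => @convh t x y l t02) mh.
rewrite (@eq_integral _ _ _ mu _ (fun s => ((1 - 6 * (s * (1 - s))) * k (s, t))%:E))//.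
by move=> s /set_mem/kE ->.
Qed.

End cone_domain_integrals.

(** * Averages over the lateral surfaces *)

Section averages.
Context {R : realType}.
Local Notation mu := (@lebesgue_measure R).
Local Notation V := (R * R * R)%type.
Variables (O e1 e2 n : vec3 R) (Rad : R).
Hypotheses (e11 : dot e1 e1 = 1) (e22 : dot e2 e2 = 1) (nn : dot n n = 1).
Hypotheses (e12 : dot e1 e2 = 0) (e1n : dot e1 n = 0) (e2n : dot e2 n = 0).
Hypothesis Rad0 : 0 < Rad.

Local Notation radial f := (fun x : vec3 R => (f x / dist_line x O n)%R).
Local Notation apex c := (vadd O (vscale c n)).

Definition cone_fun (f : V -> R) (c : R) (p : R * R) : R :=
  if p.1 == 0 then 0 else f (cone_param (apex c) O e1 e2 Rad p.1 p.2).

Let slant c : R := Num.sqrt (Rad ^+ 2 + c ^+ 2).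

Let slant_gt0 c : 0 < slant c.
Proof. by rewrite sqrtr_gt0 ltr_wpDr ?sqr_ge0 ?exprn_gt0. Qed.

(** Area element and distance to the axis are both proportional to [s], so their quotient is the
    constant [slant c] for [s > 0]; at [s = 0] both sides are [0]. *)
Lemma surf_integrand_cone (f : V -> R) c p : cone_dom p ->
  surf_integrand (cone_param (apex c) O e1 e2 Rad)
    (radial f) p = (slant c * cone_fun f c p)%:E.
Proof.
case: p => s t [/=]; rewrite in_itv/= => /andP[s0 _] _.
rewrite /surf_integrand /cone_fun /= area_elt_cone// dist_line_cone//.
rewrite -/(slant c); case: eqP => [->|/eqP sn0]; congr EFin.
  by rewrite !(mulr0, mul0r).
by field; rewrite sn0 gt_eqF.
Qed.

Section cone_average.
Variables (f : V -> R) (c : R).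
Hypothesis if_ : (@leb2 R).-integrable (@cone_dom R)
  (surf_integrand (cone_param (apex c) O e1 e2 Rad) (radial f)).

Lemma integrable_cone_fun : lebesgue2.-integrable (@cone_dom R) (EFin \o cone_fun f c).
Proof.
have mC : measurable (@cone_dom R) := measurable_cone_dom.
have i1 : lebesgue2.-integrable (@cone_dom R)
    (fun p => (slant c * cone_fun f c p)%:E).
  apply: eq_integrable if_ => // p /set_mem pC; exact: surf_integrand_cone.
have := @integrableZl _ _ _ lebesgue2 _ mC (slant c)^-1 _ i1.
apply: eq_integrable => // p _ /=; rewrite -EFinM mulKf//.
by rewrite gt_eqF.
Qed.

(** The slant height is a factor of both the surface integral and the area [pi * Rad * slant c], and
    cancels. *)
Lemma avg_cone_cone_fun : avg_cone (radial f) (apex c) O e1 e2 Rad =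
  fine (\int[lebesgue2]_(p in @cone_dom R) (cone_fun f c p)%:E) / (pi * Rad).
Proof.
have mC : measurable (@cone_dom R) := measurable_cone_dom.
have ik := integrable_cone_fun.
rewrite /avg_cone /surf_int.
have -> : (\int[@leb2 R]_(p in @cone_dom R)
    surf_integrand (cone_param (apex c) O e1 e2 Rad) (radial f) p =
    (slant c)%:E * \int[lebesgue2]_(p in @cone_dom R) (cone_fun f c p)%:E)%E.
  rewrite -integralZl//; apply: eq_integral => p /set_mem pC.
  by rewrite surf_integrand_cone// EFinM.
have -> : (\int[@leb2 R]_(p in @cone_dom R)
    surf_integrand (cone_param (apex c) O e1 e2 Rad) (fun=> 1%R) p =
    (pi * Rad * slant c)%R%:E)%E.
  pose w (s : R) := Rad * slant c * s.
  have cw : continuous w by move=> s; apply: cvgM; [exact: cvg_cst|exact: cvg_id].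
  transitivity (\int[lebesgue2]_(p in @cone_dom R) (w p.1)%:E)%E.
    apply: eq_integral => -[s t] /set_mem[/=]; rewrite in_itv/= => /andP[s0 _] _.
    rewrite /surf_integrand /= area_elt_cone// mul1r /w -/(slant c).
    by congr EFin; ring.
  rewrite (integral_cone_dom_fst cw).2.
  rewrite (_ : \int[_]_(s in _) _ = (0 + (Rad * slant c) / 2 + 0 / 3 + 0 / 4)%R%:E)%E.
    by rewrite -EFinM; congr EFin; field.
  by rewrite -integral_cubic; apply: eq_integral => s _; congr EFin; rewrite /w; ring.
rewrite fineM//=; last exact: integrable_fin_num.
have := slant_gt0 c; have := pi_gt0 R; move: (pi : R) (slant c) => q l q0 l0.
by field; rewrite !gt_eqF.
Qed.

End cone_average.

End averages.

(** * Volume of the dicone and the upper bound for the integral *)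

Section dicone_average.
Context {R : realType}.
Local Notation mu := (@lebesgue_measure R).
Local Notation V := (R * R * R)%type.
Variables (O e1 e2 n : vec3 R) (Rad a b : R).
Hypotheses (e11 : dot e1 e1 = 1) (e22 : dot e2 e2 = 1) (nn : dot n n = 1).
Hypotheses (e12 : dot e1 e2 = 0) (e1n : dot e1 n = 0) (e2n : dot e2 n = 0).
Hypotheses (Rad0 : 0 < Rad) (ab : a != b).

Local Notation D :=
  (dicone (vadd O (vscale a n)) (vadd O (vscale b n)) (circle O n Rad) : set V).
Local Notation pt := (dicone_pt O e1 e2 n Rad a b).
Local Notation box := (@cone_dom R `*` `[0, 1]).
Local Notation K := (Rad ^+ 2 * `|b - a|).
Local Notation cone c := (cone_param (vadd O (vscale c n)) O e1 e2 Rad).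

Let i1 : mu.-integrable (`[0, 1] : set R) (EFin \o cst 1).
Proof.
apply: continuous_compact_integrable; first exact: segment_compact.
by apply: continuous_subspaceT; exact: cst_continuous.
Qed.

Let iaff (c d : R) : mu.-integrable (`[0, 1] : set R) (EFin \o (fun w => c + d * w)) /\
  (\int[mu]_(w in `[0%R, 1%R]) (c + d * w)%:E = (c + d / 2)%:E)%E.
Proof.
split.
  apply: continuous_compact_integrable; first exact: segment_compact.
  apply: continuous_subspaceT => w; apply: cvgD; first exact: cvg_cst.
  by apply: cvgM; [exact: cvg_cst|exact: cvg_id].
transitivity (\int[mu]_(w in `[0%R, 1%R]) (c + d * w + 0 * w ^+ 2 + 0 * w ^+ 3)%:E)%E.
  by apply: eq_integral => w _; congr EFin; ring.
by rewrite integral_cubic; congr EFin; ring.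
Qed.

(** The Jacobian integrates to [K / 6] in [s]; the angle contributes [2 * pi] and [w] contributes
    [1]. *)
Lemma volume_dicone : lebesgue3 D = (K * pi / 3)%:E.
Proof.
have mD : measurable D by exact: measurable_dicone e11 e22 nn e12 e1n e2n Rad0 ab.
pose w (s : R) := K * (s * (1 - s)).
have cw : continuous w.
  move=> s; apply: cvgM; first exact: cvg_cst.
  by apply: cvgM; [exact: cvg_id|apply: cvgB; [exact: cvg_cst|exact: cvg_id]].
have [iw intw] := integral_cone_dom_fst cw.
have mC : measurable (@cone_dom R) := measurable_cone_dom.
transitivity (\int[lebesgue3]_(v in D) (cst 1 v))%E.
  by rewrite integral_cst// mul1e.
rewrite (ge0_integral_dicone e11 e22 nn e12 e1n e2n Rad0 ab)//.
transitivity (\int[lebesgue3]_(p in box) (w p.1.1 * cst 1 p.2)%:E)%E.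
  by apply: eq_integral => p _; rewrite /= mule1 mulr1.
rewrite (@integral_setX_mul _ _ _ _ R lebesgue2 mu _ _ (fun p => w p.1) (cst 1)
  mC (measurable_itv _) iw i1).
rewrite intw (_ : \int[_]_(s in _) _ = (0 + K / 2 + - K / 3 + 0 / 4)%R%:E)%E; last first.
  by rewrite -integral_cubic; apply: eq_integral => s _; congr EFin; rewrite /w; ring.
rewrite (_ : \int[_]_(s in _) _ = (1 + 0 / 2)%R%:E)%E; last first.
  by rewrite -(iaff 1 0).2; apply: eq_integral => s _; rewrite mul0r addr0.
by rewrite -!EFinM; congr EFin; field.
Qed.

Variable f : V -> R.
Hypothesis cf : convex_on D f.

Let dicone_pt0 s t : pt ((s, t), 0) = cone a s t.
Proof.
by rewrite dicone_ptE; apply: vec3E; rewrite /vadd /vscale /mkv /vx /vy /vz /=; ring.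
Qed.

Let dicone_pt1 s t : pt ((s, t), 1) = cone b s t.
Proof.
by rewrite dicone_ptE; apply: vec3E; rewrite /vadd /vscale /mkv /vx /vy /vz /=; ring.
Qed.

Lemma dicone_cones s t : 0 <= s <= 1 -> 0 <= t <= 2 * pi ->
  D (cone a s t) /\ D (cone b s t).
Proof.
move=> s01 t02; rewrite -dicone_pt0 -dicone_pt1; split; apply: dicone_pt_box => //;
by do ![split] => /=; rewrite in_itv//= ?lexx ?ler01.
Qed.

Lemma cone_affine c x y l t :
  cone c (l * x + (1 - l) * y) t = vadd (vscale l (cone c x t)) (vscale (1 - l) (cone c y t)).
Proof.
by rewrite !cone_paramE; apply: vec3E;
  rewrite /lincomb /vadd /vscale /mkv /vx /vy /vz /=; ring.
Qed.

Hypotheses (ia : lebesgue2.-integrable (@cone_dom R) (EFin \o cone_fun O e1 e2 n Rad f a))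
  (ib : lebesgue2.-integrable (@cone_dom R) (EFin \o cone_fun O e1 e2 n Rad f b))
  (intf : lebesgue3.-integrable D (EFin \o f)).

(** Convexity between the cones weighs the two values of [f] by [1 - w] and [w], each of integral
    [1 / 2]; the convex weight inequality along the generators contributes [1 / 6], whence
    [K / 12]. *)
Lemma integral_dicone_convex :
  (\int[lebesgue3]_(v in D) (f v)%:E <= (K / 12)%:E *
    (\int[lebesgue2]_(p in @cone_dom R) (cone_fun O e1 e2 n Rad f a p)%:E +
     \int[lebesgue2]_(p in @cone_dom R) (cone_fun O e1 e2 n Rad f b p)%:E))%E.
Proof.
have mC : measurable (@cone_dom R) := measurable_cone_dom.
have mB : measurable (box :
  set (measurableTypeR R * measurableTypeR R * measurableTypeR R)%type).
  exact: measurable_cone_dom_setX.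
pose ka := cone_fun O e1 e2 n Rad f a; pose kb := cone_fun O e1 e2 n Rad f b.
have mw : measurable_fun setT (fun s : R => s * (1 - s)).
  by apply: measurable_funM => //; exact: measurable_funB.
have w1 (s : R) : 0 <= s <= 1 -> `|s * (1 - s)| <= 1.
  by move=> /andP[s0 s1]; rewrite ler_norml; apply/andP; split; nra.
have iwa := integrable_cone_dom_mul mw w1 ia.
have iwb := integrable_cone_dom_mul mw w1 ib.
have [iw0 w0E] := iaff 1 (-1); have [iw1 w1E] := iaff 0 1.
have iA : lebesgue3.-integrable box
    (fun p => (p.1.1 * (1 - p.1.1) * ka p.1 * (1 + -1 * p.2))%:E).
  exact: (@integrable_setX_mul _ _ _ _ R lebesgue2 mu _ _
    (fun p => p.1 * (1 - p.1) * ka p) _ mC (measurable_itv _) iwa iw0).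
have iB : lebesgue3.-integrable box
    (fun p => (p.1.1 * (1 - p.1.1) * kb p.1 * (0 + 1 * p.2))%:E).
  exact: (@integrable_setX_mul _ _ _ _ R lebesgue2 mu _ _
    (fun p => p.1 * (1 - p.1) * kb p) _ mC (measurable_itv _) iwb iw1).
have IA := @integral_setX_mul _ _ _ _ R lebesgue2 mu _ _
  (fun p => p.1 * (1 - p.1) * ka p) _ mC (measurable_itv _) iwa iw0.
have IB := @integral_setX_mul _ _ _ _ R lebesgue2 mu _ _
  (fun p => p.1 * (1 - p.1) * kb p) _ mC (measurable_itv _) iwb iw1.
rewrite w0E in IA; rewrite w1E in IB.
have K0 : 0 <= K by rewrite mulr_ge0// sqr_ge0.
rewrite (integral_dicone e11 e22 nn e12 e1n e2n Rad0 ab intf).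
have le_box : (\int[lebesgue3]_(p in box) (K * (p.1.1 * (1 - p.1.1)) * f (pt p))%:E <=
    \int[lebesgue3]_(p in box) (K%:E *
      ((p.1.1 * (1 - p.1.1) * ka p.1 * (1 + -1 * p.2))%:E +
       (p.1.1 * (1 - p.1.1) * kb p.1 * (0 + 1 * p.2))%:E)))%E.
  apply: le_integral.
  - exact: mB.
  - exact: (integrable_dicone e11 e22 nn e12 e1n e2n Rad0 ab intf).
  - exact: (integrableZl mB K (integrableD mB iA iB)).
  move=> [[s t] w] /set_mem[[/= s01 t02] w01]; rewrite !in_itv/= in s01 t02 w01.
  rewrite -EFinD -EFinM lee_fin -mulrA ler_wpM2l//= /ka /kb /cone_fun /=.
  (* At the apices the factor [s] annihilates both sides, so the value [0] given to [cone_fun] there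
     does no harm. *)
  case: eqP => [->|/eqP sn0]; first by rewrite !mul0r addr0.
  have [s0 s1] := andP s01.
  have [Da Db] := dicone_cones s01 t02.
  have w01' : 0 <= 1 - w <= 1 by move/andP: w01 => []; lra.
  have := cf Da Db w01'; rewrite subKr -dicone_ptE => fw.
  have -> : s * (1 - s) * f (cone a s t) * (1 + -1 * w) +
      s * (1 - s) * f (cone b s t) * (0 + 1 * w) =
    s * (1 - s) * ((1 - w) * f (cone a s t) + w * f (cone b s t)) by ring.
  by rewrite ler_wpM2l// mulr_ge0// subr_ge0.
apply: (le_trans le_box).
rewrite (integralZl mB (integrableD mB iA iB)) (integralD mB iA iB).
have convh c : (c = a) \/ (c = b) -> forall t x y l : R, (0 <= t <= 2 * pi)%R ->
    (0 <= x <= 1)%R -> (0 <= y <= 1)%R -> (0 <= l <= 1)%R ->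
    (f (cone c (l * x + (1 - l) * y) t) <=
     l * f (cone c x t) + (1 - l) * f (cone c y t))%R.
  move=> cab t x y l t02 x01 y01 l01; rewrite cone_affine; apply: cf => //.
    by case: cab => ->; [exact: (dicone_cones x01 t02).1|exact: (dicone_cones x01 t02).2].
  by case: cab => ->; [exact: (dicone_cones y01 t02).1|exact: (dicone_cones y01 t02).2].
have Wa := cone_dom_convex_weight (h := fun s t => f (cone a s t))
  (convh a (or_introl erefl)) ia.
have Wb := cone_dom_convex_weight (h := fun s t => f (cone b s t))
  (convh b (or_intror erefl)) ib.
rewrite [X in (_ * (X + _) <= _)%E]IA [X in (_ * (_ + X) <= _)%E]IB.
rewrite -/ka -/kb.
have fin h : lebesgue2.-integrable (@cone_dom R) (EFin \o h) ->
    exists r : R, (\int[lebesgue2]_(p in @cone_dom R) (h p)%:E = r%:E)%E.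
  move=> ih; exists (fine (\int[lebesgue2]_(p in @cone_dom R) (h p)%:E)%E).
  by rewrite fineK//; exact: integrable_fin_num.
have [ja Ja] := fin (fun p => p.1 * (1 - p.1) * ka p) iwa.
have [jb Jb] := fin (fun p => p.1 * (1 - p.1) * kb p) iwb.
have [ra Ra] := fin ka ia; have [rb Rb] := fin kb ib.
move: Wa Wb; rewrite -/(ka _) Ja Jb Ra Rb -!EFinD -!EFinM -?EFinD -?EFinM !lee_fin => Wa Wb.
have -> : K * (ja * (1 + -1 / 2) + jb * (0 + 1 / 2)) = K * ((ja + jb) / 2) by field.
have -> : K / 12 * (ra + rb) = K * ((ra + rb) / 12) by field.
by apply: ler_wpM2l => //; lra.
Qed.

End dicone_average.

Unset Implicit Arguments.

Theorem theorem7p4 (R : realType) (O n e1 e2 O0 O1 : vec3 R) (Rad : R)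
  (f : vec3 R -> R) :
  vnorm n = 1 ->
  0 < Rad ->
  (* e1, e2: an orthonormal basis of the direction plane of Pi (used only to
     parametrise the lateral surfaces) *)
  vnorm e1 = 1 -> vnorm e2 = 1 -> dot e1 e2 = 0 -> dot e1 n = 0 -> dot e2 n = 0 ->
  line O n O0 -> line O n O1 -> ~ plane O n O0 -> ~ plane O n O1 -> O0 <> O1 ->
  let Gam := circle O n Rad in
  let D := dicone O0 O1 Gam in
  let g := fun x => f x / dist_line x O n in
  convex_on D f ->
  (@leb3 R).-integrable D (EFin \o f) ->
  (@leb2 R).-integrable (@cone_dom R) (surf_integrand (cone_param O0 O e1 e2 Rad) g) ->
  (@leb2 R).-integrable (@cone_dom R) (surf_integrand (cone_param O1 O e1 e2 Rad) g) ->
  avg_vol f D <= Rad / 4 * (avg_cone g O0 O e1 e2 Rad + avg_cone g O1 O e1 e2 Rad).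
Proof.
move=> n1 Rad0 h1 h2 e12 e1n e2n [a _ <-] [b _ <-] _ _ O01 Gam D g cf intf ia ib.
have e11 := vnorm1_dot h1; have e22 := vnorm1_dot h2; have nn := vnorm1_dot n1.
have ab : a != b by apply: contra_notN O01 => /eqP ->.
have b_a : 0 < `|b - a| by rewrite normr_gt0 subr_eq0 eq_sym.
have ka := integrable_cone_fun e11 e22 nn e12 e1n e2n Rad0 ia.
have kb := integrable_cone_fun e11 e22 nn e12 e1n e2n Rad0 ib.
rewrite /g (avg_cone_cone_fun e11 e22 nn e12 e1n e2n Rad0 ia).
rewrite (avg_cone_cone_fun e11 e22 nn e12 e1n e2n Rad0 ib).
have vol := volume_dicone O e11 e22 nn e12 e1n e2n Rad0 ab.
have mD := measurable_dicone O e11 e22 nn e12 e1n e2n Rad0 ab.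
have If : (\int[@leb3 R]_(x in D) (f x)%:E)%E \is a fin_num.
  exact: (@integrable_fin_num _ _ _ lebesgue3 _ mD _ intf).
have Ia := @integrable_fin_num _ _ _ lebesgue2 _ measurable_cone_dom _ ka.
have Ib := @integrable_fin_num _ _ _ lebesgue2 _ measurable_cone_dom _ kb.
have := integral_dicone_convex e11 e22 nn e12 e1n e2n Rad0 ab cf ka kb intf.
rewrite /avg_vol -[@leb3 R D]/(lebesgue3 D) vol -[X in (X <= _)%E](fineK If) -(fineK Ia) -(fineK Ib).
rewrite -EFinD -EFinM lee_fin /=.
move: (fine _) (fine _) (fine _) (pi_gt0 R) => I J L; move: (pi : R) => p p0 le_I.
rewrite ler_pdivrMr; last by rewrite divr_gt0// !mulr_gt0// exprn_gt0.
(* What remains is an equality: with [K = Rad ^+ 2 * |b - a|], dividing [K / 12] by the volume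
   [K * pi / 3] gives [1 / (4 * pi)], which is [Rad / 4] times the factor [1 / (pi * Rad)] of each
   average. *)
apply: (le_trans le_I); rewrite le_eqVlt; apply/orP; left; apply/eqP.
by field; rewrite !gt_eqF.
Qed.
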